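(* Let $(X_n)_{n\geq -1}$ be a second-order Galton--Watson process with immigration with generic offspring variables $\xi,\eta$ and generic immigration variable $\varepsilon$, such that $\xi$, $\eta$ and $\varepsilon$ are regularly varying with index $\alpha\in[1,\infty)$, $\mathbb{P}(\xi>x)\asymp\mathbb{P}(\eta>x)$, $\mathbb{P}(\xi>x)=O(\mathbb{P}(\varepsilon>x))$ and $\mathbb{P}(\eta>x)=O(\mathbb{P}(\varepsilon>x))$ as $x\to\infty$, $m_\xi,m_\eta,m_\varepsilon\in(0,\infty)$, and there exists $r\in(\alpha,\infty)$ such that $\mathbb{E}(X_0^r)<\infty$ and $\mathbb{E}(X_{-1}^r)<\infty$. Then for all $n\in\mathbb{N}$, writing $u(x) := (\mathbb{P}(\xi>x), \mathbb{P}(\eta>x))^\top$, \begin{align*} \mathbb{P}(X_n > x) &\sim \begin{bmatrix}\mathbb{E}(X_0)\\ \mathbb{E}(X_{-1})\end{bmatrix}^\top \sum_{k=0}^{n-1} m_k^\alpha \bigl(M^{n-k-1}\bigr)^\top u(x) + \begin{bmatrix} m_\varepsilon \\ 0\end{bmatrix}^\top \sum_{i=1}^{n-1}\sum_{j=0}^{n-i-1} m_j^\alpha \bigl(M^{n-i-j-1}\bigr)^\top u(x) \\ &\quad + \sum_{i=1}^n m_{n-i}^\alpha\,\mathbb{P}(\varepsilon>x) \end{align*} as $x\to\infty$, yielding that $X_n$ is regularly varying with index $\alpha$.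
   Context: A second-order Galton--Watson process with immigration $(X_n)_{n\geq -1}$ is defined by $X_n = \sum_{i=1}^{X_{n-1}} \xi_{n,i} + \sum_{j=1}^{X_{n-2}} \eta_{n,j} + \varepsilon_n$ for $n\in\mathbb{N}=\{1,2,\dots\}$, where $X_{-1}, X_0$ (initial values) and all $\xi_{n,i},\eta_{n,j},\varepsilon_n$ ($n,i,j\in\mathbb{N}$) are independent non-negative integer-valued random variables, the $\xi_{n,i}$ are identically distributed with generic copy $\xi$, the $\eta_{n,j}$ identically distributed with generic copy $\eta$, and the $\varepsilon_n$ identically distributed with generic copy $\varepsilon$. Write $m_\xi=\mathbb{E}(\xi)$, $m_\eta=\mathbb{E}(\eta)$, $m_\varepsilon=\mathbb{E}(\varepsilon)$, and $M := \begin{bmatrix} m_\xi & m_\eta\\ 1 & 0\end{bmatrix}$. Set $m_0:=1$ and for $k\in\mathbb{N}$, $m_k := \frac{\lambda_+^{k+1}-\lambda_-^{k+1}}{\lambda_+-\lambda_-}$ with $\lambda_\pm := \frac{m_\xi \pm \sqrt{m_\xi^2+4m_\eta}}{2}$. A non-negative random variable $X$ is regularly varying with index $\alpha\geq 0$ if $\lim_{x\to\infty}\mathbb{P}(X>qx)/\mathbb{P}(X>x) = q^{-\alpha}$ for all $q>0$. For positive functions, $f\sim g$ means $f/g\to1$, $f=O(g)$ means $\limsup f/g<\infty$, and $f\asymp g$ means $f=O(g)$ and $g=O(f)$, as $x\to\infty$. *)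

(* Defs.v *)
From HB Require Import structures.
From mathcomp Require Import all_boot all_order all_algebra.
From mathcomp Require Import all_classical all_reals all_analysis.
Set Implicit Arguments. Unset Strict Implicit. Unset Printing Implicit Defensive.
Import Order.TTheory GRing.Theory Num.Theory.
Import numFieldNormedType.Exports.
Local Open Scope classical_set_scope.
Local Open Scope ring_scope.

Section GW.
Context {d : measure_display} {T : measurableType d} {R : realType}.
Variable P : probability T R.

Definition tailP (X : T -> nat) (x : R) : R :=
  fine (P [set w | x < (X w)%:R]).

Definition meanE (X : T -> nat) : \bar R := (\int[P]_w ((X w)%:R)%:E)%E.
Definition momentE (X : T -> nat) (r : R) : \bar R :=
  (\int[P]_w (((X w)%:R) `^ r)%:E)%E.

Definition nat_rv (X : T -> nat) : Prop := forall k : nat, measurable (X @^-1` [set k]).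

Definition mutually_indep {I : eqType} (Y : I -> T -> nat) : Prop :=
  forall (s : seq I) (A : I -> set nat), uniq s ->
    fine (P (\big[setI/setT]_(i <- s) (Y i @^-1` A i)))
    = \prod_(i <- s) fine (P (Y i @^-1` A i)).

Definition same_law (X Y : T -> nat) : Prop :=
  forall k : nat, P (X @^-1` [set k]) = P (Y @^-1` [set k]).

Definition reg_var (X : T -> nat) (alpha : R) : Prop :=
  forall q : R, 0 < q ->
    (tailP X (q * x) / tailP X x) @[x --> +oo] --> q `^ (- alpha).
End GW.

Definition asym_equiv {R : realType} (f g : R -> R) : Prop :=
  (f x / g x) @[x --> +oo] --> (1 : R).
Definition bigO_inf {R : realType} (f g : R -> R) : Prop :=
  exists C : R, \forall x \near +oo, f x / g x <= C.
Definition asymp {R : realType} (f g : R -> R) : Prop :=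
  bigO_inf f g /\ bigO_inf g f.

(* Index type of the family of independent variables:
   inl true = X_0, inl false = X_{-1},
   inr (inl (n,i)) = xi_{n+1,i+1}, inr (inr (inl (n,j))) = eta_{n+1,j+1},
   inr (inr (inr n)) = eps_{n+1}. *)
Definition gw_idx := (bool + ((nat * nat) + ((nat * nat) + nat)))%type.

Definition gw_family {T : Type} (Xm1 X0 : T -> nat) (xi eta : nat -> nat -> T -> nat)
  (eps : nat -> T -> nat) (k : gw_idx) : T -> nat :=
  match k with
  | inl b => if b then X0 else Xm1
  | inr (inl (n, i)) => xi n i
  | inr (inr (inl (n, j))) => eta n j
  | inr (inr (inr n)) => eps n
  end.

(* The second-order GW process with immigration.
   gw_pair n w = (X_{n-1}(w), X_n(w)); convention: xi n i = xi_{n+1,i+1} etc. so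
   X_{n+1} = sum_{i=1}^{X_n} xi_{n+1,i} + sum_{j=1}^{X_{n-1}} eta_{n+1,j} + eps_{n+1}. *)
Fixpoint gw_pair {T : Type} (Xm1 X0 : T -> nat) (xi eta : nat -> nat -> T -> nat)
  (eps : nat -> T -> nat) (n : nat) (w : T) : nat * nat :=
  match n with
  | 0 => (Xm1 w, X0 w)
  | m.+1 => let p := gw_pair Xm1 X0 xi eta eps m w in
            (p.2, (\sum_(i < p.2) xi m i w + \sum_(j < p.1) eta m j w + eps m w)%N)
  end.

Definition gw_X {T : Type} Xm1 X0 xi eta eps (n : nat) (w : T) : nat :=
  (gw_pair Xm1 X0 xi eta eps n w).2.

Section Consts.
Local Open Scope ring_scope.
Context {R : realType}.
Definition Mmat (mxi meta : R) : 'M[R]_2 :=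
  \matrix_(i < 2, j < 2) if i == 0 then (if j == 0 then mxi else meta)
                         else (if j == 0 then 1 else 0).
Definition lam_plus (mxi meta : R) : R := (mxi + Num.sqrt (mxi ^+ 2 + 4 * meta)) / 2.
Definition lam_minus (mxi meta : R) : R := (mxi - Num.sqrt (mxi ^+ 2 + 4 * meta)) / 2.
Definition mk (mxi meta : R) (k : nat) : R :=
  if k == 0%N then 1 else
  (lam_plus mxi meta ^+ k.+1 - lam_minus mxi meta ^+ k.+1)
    / (lam_plus mxi meta - lam_minus mxi meta).
Definition col2 (a b : R) : 'cV[R]_2 := \col_(i < 2) if i == 0 then a else b.
End Consts.

(* Main.v *)
(* Idea: the principle of a single big jump, applied to all linear combinations
   a X_n + b X_{n-1} with a, b >= 0 at once, so that the branching decomposition of X_n is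
   not needed. Write g(x) = P(eps > x). Given (X_n, X_{n-1}) = (u, v), the variable X_{n+1}
   is a sum of u + v + 1 independent summands, and a X_{n+1} + b X_n exceeds x essentially
   in two ways: one summand exceeds x / a, or the conditional mean
   (a m_xi + b) u + a m_eta v exceeds x. Averaging over (u, v), up to o(g(x)),
     P(a X_{n+1} + b X_n > x) = a^alpha (E X_n P(xi > x) + E X_{n-1} P(eta > x) + g(x))
                                + P((a m_xi + b) X_n + a m_eta X_{n-1} > x),
   and the last term is of the same kind, one generation earlier. The initial term is o(g)
   by the moment hypotheses, and the coefficients generated from (a, b) = (1, 0) are the m_k.

   With only a finite mean available (alpha may be 1), the deviations without big summand
   are controlled by truncated exponential moments: if u + v <= kappa x, Bennett's bound
   (C (u + v) / x)^K is averaged using P(u + v > x) = O(g(x)) and K > alpha; if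
   u + v > kappa x, a weak law of large numbers suffices. *)
Require Import Defs.
From HB Require Import structures.
From mathcomp Require Import all_boot all_order all_algebra.
From mathcomp Require Import all_classical all_reals all_analysis.
From mathcomp Require Import measurable_realfun.
From mathcomp Require Import ring lra zify.
Import Order.TTheory GRing.Theory Num.Theory.
Import numFieldNormedType.Exports.
Set Implicit Arguments. Unset Strict Implicit. Unset Printing Implicit Defensive.
Local Open Scope classical_set_scope.
Local Open Scope ring_scope.

(** * Asymptotics at infinity *)

Section Asymptotics.
Context {R : realType}.
Implicit Types (f g h : R -> R).

(** The bounds given (X_{n-1}, X_n) = q are integrated over q afterwards. Each of them therefore has
    to hold beyond a threshold in x that does not depend on q, with an error whose average is o(g).
    For this reason the errors stay explicit functions of the number N of summands. One type is N
    min(1, s N), whose mean tends to 0 with s. The other is (N / x)^K on N <= kappa x: as g(kappa x)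
    is about kappa^(-alpha) g(x), its average is of order kappa^(K - alpha) g(x), which is small
    with kappa. The remaining event N > kappa x has probability of order kappa^(-alpha) g(x), so the
    error of its weak law is fixed only after kappa.

    Asymptotic relations are differences of size o(g) and not quotients: the main term is 0 at
    generation 0, and the offspring tails may be negligible against g. Quotients come back at the
    very end, where the latest immigration makes the main term at least g. *)

Lemma near_pinfty_ge (c : R) : \forall x \near +oo, c <= x.
Proof. by apply: nbhs_pinfty_ge; rewrite num_real. Qed.

Lemma near_pinftyZ (q : R) (A : R -> Prop) : 0 < q ->
  (\forall x \near +oo, A x) -> \forall x \near +oo, A (q * x).
Proof.
move=> q0 [M [_ hM]]; exists (M / q); split; first by rewrite num_real.
by move=> x /=; rewrite ltr_pdivrMr // mulrC => /hM.
Qed.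

(* [negl g f] and [asymO g f] are [f = o(g)] and [f = O(g)] at infinity. *)
Definition negl g f := forall e : R, 0 < e -> \forall x \near +oo, `|f x| <= e * g x.
Definition asymO g f := exists C : R, \forall x \near +oo, `|f x| <= C * g x.

Lemma negl_near g f h : (\forall x \near +oo, `|f x| <= `|h x|) -> negl g h -> negl g f.
Proof.
move=> fh nh e e0; near=> x; apply: le_trans (_ : `|h x| <= _); near: x => //.
exact: nh.
Unshelve. all: by end_near. Qed.

Lemma negl_ext g f h : (forall x, f x = h x) -> negl g h -> negl g f.
Proof. by move=> fh; apply: negl_near; near=> x; rewrite fh.
Unshelve. all: by end_near. Qed.

Lemma neglD g f h : negl g f -> negl g h -> negl g (fun x => f x + h x).
Proof.
move=> nf nh e e0; have e20 : 0 < e / 2 by lra.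
near=> x.
have h1 : `|f x| <= e / 2 * g x by near: x; exact: nf.
have h2 : `|h x| <= e / 2 * g x by near: x; exact: nh.
apply: le_trans (ler_normD _ _) _; lra.
Unshelve. all: by end_near. Qed.

Lemma neglZ g f (c : R) : negl g f -> negl g (fun x => c * f x).
Proof.
move=> nf e e0; have c0 : 0 < `|c| + 1 by have := normr_ge0 c; lra.
have e1 : 0 < e / (`|c| + 1) by rewrite divr_gt0.
near=> x.
have h1 : `|f x| <= e / (`|c| + 1) * g x by near: x; exact: nf.
rewrite normrM; apply: le_trans (_ : (`|c| + 1) * (e / (`|c| + 1) * g x) <= _).
  by apply: ler_pM => //; lra.
by rewrite mulrA mulrCA divff ?mulr1 // gt_eqF.
Unshelve. all: by end_near. Qed.

Lemma neglB g f h : negl g f -> negl g h -> negl g (fun x => f x - h x).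
Proof.
move=> nf /(neglZ (-1)) nh; apply: negl_ext (neglD nf nh) => x /=; ring.
Qed.

Lemma negl0 g : (forall x, 0 <= g x) -> negl g (fun=> 0).
Proof.
move=> g0 e e0; near=> x; rewrite normr0 mulr_ge0 // ltW //.
Unshelve. all: by end_near. Qed.

Lemma asymO_pos g f : (forall x, 0 <= g x) -> asymO g f ->
  exists2 C : R, 0 < C & \forall x \near +oo, `|f x| <= C * g x.
Proof.
move=> g0 [C hC]; exists (`|C| + 1); first by have := normr_ge0 C; lra.
near=> x; apply: le_trans (_ : C * g x <= _); first by near: x.
by apply: ler_wpM2r => //; have := ler_norm C; lra.
Unshelve. all: by end_near. Qed.

Lemma asymOD g f h : asymO g f -> asymO g h -> asymO g (fun x => f x + h x).
Proof.
move=> [C hC] [D hD]; exists (C + D); near=> x.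
apply: le_trans (ler_normD _ _) _; rewrite mulrDl lerD //; near: x => //.
Unshelve. all: by end_near. Qed.

Lemma asymOZ g f (c : R) : asymO g f -> asymO g (fun x => c * f x).
Proof.
move=> [C hC]; exists (`|c| * C); near=> x.
by rewrite normrM -mulrA ler_wpM2l //; near: x.
Unshelve. all: by end_near. Qed.

Lemma negl_asymO g f : negl g f -> asymO g f.
Proof. by move=> nf; exists 1; apply: nf. Qed.

Lemma negl_trans g h f : (forall x, 0 <= g x) -> (forall x, 0 <= h x) ->
  negl h f -> asymO g h -> negl g f.
Proof.
move=> g0 h0 nf /(asymO_pos g0)[C C0 hC] e e0.
have e1 : 0 < e / C by rewrite divr_gt0.
near=> x; apply: le_trans (_ : e / C * h x <= _); first by near: x; exact: nf.
rewrite mulrAC ler_pdivrMr // -mulrA ler_pM2l // mulrC.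
by rewrite -[h x]ger0_norm //; near: x.
Unshelve. all: by end_near. Qed.

(** Induction on dyadic scales: repeated halving brings any x >= x0 into the base interval
    [x0, 2 x0]. It serves in place of Potter's bounds when a function is compared with a regularly
    varying one at all scales. *)
Lemma doubling_bound f (x0 B : R) : 0 < x0 ->
  (forall x, x0 <= x <= 2 * x0 -> f x <= B) ->
  (forall x, x0 <= x -> f x <= B -> f (2 * x) <= B) ->
  forall x, x0 <= x -> f x <= B.
Proof.
move=> x00 hb hd.
have key n : forall x, x0 <= x -> x <= 2 ^+ n.+1 * x0 -> f x <= B.
  elim: n => [|n IH] x hx hxn; first by apply: hb; rewrite hx /= -[2]expr1.
  case: (lerP x (2 * x0)) => h; first by apply: hb; rewrite hx.
  rewrite -[x](_ : 2 * (x / 2) = x); last by field.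
  apply: hd; first lra.
  apply: IH; first lra.
  by move: hxn; rewrite exprS; lra.
move=> x hx; apply: (key (Num.truncn (x / x0))) => //.
rewrite -ler_pdivrMr //; apply: le_trans (ltW (truncnS_gt _)) _.
rewrite -natrX ler_nat; apply: ltnW; exact: ltn_expl.
Qed.

(** * Regular variation relative to a reference tail *)

Section Index.
Variables (g : R -> R) (alpha : R).
Hypothesis g_gt0 : forall x, 0 < g x.
Hypothesis g_noninc : forall x y, x <= y -> g y <= g x.
Hypothesis g_rv : forall q, 0 < q -> negl g (fun x => g (q * x) - q `^ (- alpha) * g x).

Let g_ge0 x : 0 <= g x := ltW (g_gt0 x).

(* Regular variation up to [o(g)]: contrary to the quotient form, it is stable under all
   nonnegative linear combinations, including 0. *)
Definition rvO f := [/\ forall x, 0 <= f x, asymO g f &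
  forall q, 0 < q -> negl g (fun x => f (q * x) - q `^ (- alpha) * f x)].

Lemma g_scale_le (q c : R) : 0 < q -> q `^ (- alpha) < c ->
  \forall x \near +oo, g (q * x) <= c * g x.
Proof.
move=> q0 qc; near=> x.
have : `|g (q * x) - q `^ (- alpha) * g x| <= (c - q `^ (- alpha)) * g x.
  by near: x; apply: g_rv => //; rewrite subr_gt0.
by move/(le_trans (ler_norm _)); lra.
Unshelve. all: by end_near. Qed.

Lemma g_scale_ge (q c : R) : 0 < q -> c < q `^ (- alpha) ->
  \forall x \near +oo, c * g x <= g (q * x).
Proof.
move=> q0 qc; near=> x.
have : `|g (q * x) - q `^ (- alpha) * g x| <= (q `^ (- alpha) - c) * g x.
  by near: x; apply: g_rv => //; rewrite subr_gt0.
by rewrite ler_norml => /andP[+ _]; lra.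
Unshelve. all: by end_near. Qed.

Lemma asymO_scale f (q : R) : 0 < q -> asymO g f -> asymO g (fun x => f (q * x)).
Proof.
move=> q0 /(asymO_pos g_ge0)[C C0 hC]; exists (C * (q `^ (- alpha) + 1)).
near=> x; apply: le_trans (_ : C * g (q * x) <= _).
  by near: x; exact: (near_pinftyZ q0 hC).
by rewrite -mulrA ler_pM2l //; near: x; apply: g_scale_le => //; rewrite ltrDl.
Unshelve. all: by end_near. Qed.

Lemma negl_scale f (q : R) : 0 < q -> negl g f -> negl g (fun x => f (q * x)).
Proof.
move=> q0 nf e e0.
have c0 : 0 < q `^ (- alpha) + 1 by rewrite ltr_pwDr // powR_ge0.
have e1 : 0 < e / (q `^ (- alpha) + 1) by rewrite divr_gt0.
near=> x; apply: le_trans (_ : e / (q `^ (- alpha) + 1) * g (q * x) <= _).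
  by near: x; exact: (near_pinftyZ q0 (nf _ e1)).
rewrite mulrAC ler_pdivrMr // -mulrA ler_pM2l // [g x * _]mulrC.
by near: x; apply: g_scale_le => //; rewrite ltrDl.
Unshelve. all: by end_near. Qed.

Lemma rvO_self : rvO g.
Proof.
split=> //; exists 1; near=> x; rewrite mul1r ger0_norm //.
Unshelve. all: by end_near. Qed.

Lemma rvO0 : rvO (fun=> 0).
Proof.
split=> [//||q q0]; first exact/negl_asymO/negl0.
by apply: negl_ext (negl0 g_ge0) => x; rewrite mulr0 subr0.
Qed.

Lemma rvOD f h : rvO f -> rvO h -> rvO (fun x => f x + h x).
Proof.
move=> [f0 Of nf] [h0 Oh nh]; split=> [x||q q0].
- by rewrite addr_ge0.
- exact: asymOD.
- by apply: negl_ext (neglD (nf _ q0) (nh _ q0)) => x /=; ring.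
Qed.

Lemma rvOZ f (c : R) : 0 <= c -> rvO f -> rvO (fun x => c * f x).
Proof.
move=> c0 [f0 Of nf]; split=> [x||q q0].
- by rewrite mulr_ge0.
- exact: asymOZ.
- by apply: negl_ext (neglZ c (nf _ q0)) => x /=; ring.
Qed.

Lemma rvOZr f (c : R) : 0 <= c -> rvO f -> rvO (fun x => f x * c).
Proof.
move=> c0 hf; rewrite (_ : (fun x => f x * c) = (fun x => c * f x)); first exact: rvOZ.
by apply/funext => x; rewrite mulrC.
Qed.

(** Carries regular variation from an explicit main term over to the tail that it approximates,
    which the induction on generations needs at each stage. *)
Lemma rvO_negl f h : (forall x, 0 <= f x) -> rvO h ->
  negl g (fun x => f x - h x) -> rvO f.
Proof.
move=> f0 [h0 Oh nh] nfh; split=> // [|q q0].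
  have [C hC] := asymOD (negl_asymO nfh) Oh.
  by exists C; near=> x; rewrite -[f x](subrK (h x)); near: x.
apply: negl_ext (neglD (nh _ q0) (neglB (negl_scale q0 nfh) (neglZ (q `^ (- alpha)) nfh))) => x /=.
ring.
Unshelve. all: by end_near. Qed.

Lemma powR_near1 (e : R) : 0 < e -> exists2 del : R, 0 < del < 1 &
  forall t, `|t - 1| <= del -> `|t `^ (- alpha) - 1| <= e.
Proof.
move=> e0; have h1 : (0 : R) < 1 by [].
have dp := @ex_derive _ _ _ _ _ _ _ (is_derive1_powR (- alpha) h1).
have /cvgrPdist_le/(_ _ e0) := differentiable_continuous (proj1 (derivable1_diffP _ _) dp).
rewrite powR1 => -[d /= d0 hd]; exists (Num.min (d / 2) (1 / 2)).
  rewrite lt_min; apply/andP; split; [apply/andP; split; lra|].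
  by rewrite gt_min; apply/orP; right; lra.
move=> t; rewrite le_min => /andP[ht _]; rewrite distrC; apply: hd => /=.
by rewrite distrC; apply: le_lt_trans ht _; lra.
Qed.

(** The probabilistic bounds lose a factor 1 - del or 1 + del in the argument. Regular variation
    turns it into a factor (1 - del)^(-alpha) or (1 + del)^(-alpha), close to 1, and [h = O(g)]
    makes the resulting error a small multiple of g. *)
Lemma negl_sandwich f h : rvO h ->
  (forall del e : R, 0 < del < 1 -> 0 < e -> \forall x \near +oo,
     f x <= h ((1 - del) * x) + e * g x) ->
  (forall del e : R, 0 < del < 1 -> 0 < e -> \forall x \near +oo,
     h ((1 + del) * x) - e * g x <= f x) ->
  negl g (fun x => f x - h x).
Proof.
move=> [h0 Oh nh] hup hlo e e0.
have [C C0 hC] := asymO_pos g_ge0 Oh.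
have e3 : 0 < e / 3 by lra.
have eC : 0 < e / 3 / C by rewrite divr_gt0.
have [del d01 hd] := powR_near1 eC.
have {}hd t : `|t - 1| <= del -> forall x, `|h x| <= C * g x ->
    `|t `^ (- alpha) * h x - h x| <= e / 3 * g x.
  move=> /hd ht x hx; rewrite -[X in _ - X]mul1r -mulrBl normrM.
  apply: le_trans (ler_pM _ _ ht hx) _ => //.
  by rewrite mulrA divfK // gt_eqF.
have dm : `|1 - del - 1| <= del.
  by rewrite addrAC subrr sub0r normrN ger0_norm //; lra.
have dp : `|1 + del - 1| <= del.
  by rewrite addrAC subrr add0r ger0_norm //; lra.
have dm0 : 0 < 1 - del by lra.
have dp0 : 0 < 1 + del by lra.
near=> x.
have k0 : `|h x| <= C * g x by near: x.
have := hd _ dm x k0; have := hd _ dp x k0.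
have : f x <= h ((1 - del) * x) + e / 3 * g x by near: x; exact: hup.
have : h ((1 + del) * x) - e / 3 * g x <= f x by near: x; exact: hlo.
have : `|h ((1 - del) * x) - (1 - del) `^ (- alpha) * h x| <= e / 3 * g x.
  by near: x; exact: nh.
have : `|h ((1 + del) * x) - (1 + del) `^ (- alpha) * h x| <= e / 3 * g x.
  by near: x; exact: nh.
rewrite !ler_norml => /andP[? ?] /andP[? ?] ? ? /andP[? ?] /andP[? ?].
apply/andP; split; lra.
Unshelve. all: by end_near. Qed.

(** For an exponent r' strictly between alpha and r, doubling x multiplies x^(-r') by 2^(-r') while
    g keeps eventually at least that fraction. Hence x^(-r') = O(g), and the spare factor x^(r' - r)
    tends to 0. This is how a moment of order r > alpha makes the initial values negligible. *)
Lemma negl_powR (r : R) : 0 <= alpha -> alpha < r -> negl g (fun x => x `^ (- r)).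
Proof.
move=> a0 ar; pose r' := (alpha + r) / 2.
have /(g_scale_ge (ltr0n _ 2))[M [_ hM]] : (2 : R) `^ (- r') < 2 `^ (- alpha).
  by rewrite /powR pnatr_eq0 /= ltr_expR ltr_pM2r ?ln_gt0 ?ltr1n // /r'; lra.
pose x0 := Num.max M 0 + 1.
have x00 : 0 < x0 by rewrite ltr_wpDl // le_max lexx orbT.
have x0M : M < x0 by rewrite ltr_pwDr // le_max lexx.
pose B := x0 `^ (- r') / g (2 * x0).
have B0 : 0 < B by rewrite divr_gt0 // powR_gt0.
have hB : forall x, x0 <= x -> x `^ (- r') / g x <= B.
  apply: doubling_bound => // x.
    move=> /andP[h1 h2]; apply: ler_pM; rewrite ?powR_ge0 ?invr_ge0 //.
      rewrite !powRN lef_pV2 ?posrE ?powR_gt0 //; last by lra.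
      rewrite ge0_ler_powR ?nnegrE //; rewrite /r'; lra.
    by rewrite lef_pV2 ?posrE // g_noninc.
  move=> hx; rewrite !ler_pdivrMr // => hB; rewrite powRM ?powR_ge0 //; last by lra.
  apply: le_trans (_ : B * (2 `^ (- r') * g x) <= _).
    by rewrite mulrCA ler_pM2l // powR_gt0.
  by rewrite ler_pM2l //; apply: hM; lra.
move=> e e0; pose s := r - r'.
have s0 : 0 < s by rewrite /s /r'; lra.
near=> x.
have hx : x0 <= x by near: x; exact: near_pinfty_ge.
have hx2 : (B / e) `^ s^-1 <= x by near: x; exact: near_pinfty_ge.
have x_gt0 : 0 < x by lra.
rewrite ger0_norm ?powR_ge0 //.
have -> : - r = - s - r' by rewrite /s; lra.
rewrite powRD; last by rewrite (gt_eqF x_gt0) implybT.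
have := hB _ hx; rewrite ler_pdivrMr // => h1.
apply: le_trans (ler_wpM2l (powR_ge0 _ _) h1) _.
rewrite mulrA ler_wpM2r // powRN mulrC ler_pdivrMr ?powR_gt0 // mulrC -ler_pdivrMr //.
apply: le_trans (_ : ((B / e) `^ s^-1) `^ s <= _).
  by rewrite -powRrM mulVf ?gt_eqF // powRr1 // divr_ge0 // ltW.
by rewrite ge0_ler_powR ?nnegrE ?powR_ge0 // ltW.
Unshelve. all: by end_near. Qed.

End Index.
End Asymptotics.

(** * Discrete random variables and independence *)

Section Discrete.
Context {d : measure_display} {T : measurableType d} {R : realType}.

(** Measurable fibres suffice for countable values: every preimage is a countable union of fibres,
    so any function of such a variable is measurable and conditioning amounts to restriction to
    fibres. *)
Definition drv {C : countType} (Y : T -> C) := forall c, measurable (Y @^-1` [set c]).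

Lemma drv_preimage (C : countType) (Y : T -> C) (A : set C) :
  drv Y -> measurable (Y @^-1` A).
Proof.
move=> mY.
have -> : Y @^-1` A = \bigcup_n (if pickle_inv n is Some c then
    (if `[<A c>] then Y @^-1` [set c] else set0) else set0).
  apply/seteqP; split=> w /=.
    by move=> Aw; exists (pickle (Y w)) => //=; rewrite pickleK_inv asboolT.
  by move=> [n _]; case: pickle_inv => // c; case: asboolP => // Ac /= Yw; rewrite Yw.
apply: bigcup_measurable => n _; case: pickle_inv => [c|//]; case: asboolP => // _.
Qed.

Lemma drv_comp (C C' : countType) (Y : T -> C) (h : C -> C') :
  drv Y -> drv (fun w => h (Y w)).
Proof. by move=> mY c; apply: (drv_preimage [set x | h x = c]). Qed.

Lemma drv_pair (C C' : countType) (Y : T -> C) (Y' : T -> C') :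
  drv Y -> drv Y' -> drv (fun w => (Y w, Y' w)).
Proof.
move=> mY mY' [c c'].
rewrite (_ : _ @^-1` _ = Y @^-1` [set c] `&` Y' @^-1` [set c']); first exact: measurableI.
by apply/seteqP; split=> w /= [-> ->].
Qed.

Lemma drv_measurable (C : countType) (Y : T -> C) (h : C -> R) :
  drv Y -> measurable_fun setT (fun w => h (Y w)).
Proof. by move=> mY _ B mB; rewrite setTI; apply: (drv_preimage (h @^-1` B)). Qed.

Definition nnmf (f : T -> R) := measurable_fun setT f /\ forall w, 0 <= f w.

Lemma nnmf_drv (C : countType) (Y : T -> C) (h : C -> R) :
  drv Y -> (forall c, 0 <= h c) -> nnmf (fun w => h (Y w)).
Proof. by move=> mY h0; split=> //; exact: drv_measurable. Qed.

Lemma nnmfD f g : nnmf f -> nnmf g -> nnmf (fun w => f w + g w).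
Proof. by move=> [mf f0] [mg g0]; split=> [|w]; [apply: measurable_funD|rewrite addr_ge0]. Qed.

Lemma nnmfM f g : nnmf f -> nnmf g -> nnmf (fun w => f w * g w).
Proof. by move=> [mf f0] [mg g0]; split=> [|w]; [exact: measurable_funM|rewrite mulr_ge0]. Qed.

Lemma nnmf_cst (c : R) : 0 <= c -> nnmf (fun=> c).
Proof. by move=> c0; split. Qed.

Lemma nnmfZ (c : R) f : 0 <= c -> nnmf f -> nnmf (fun w => c * f w).
Proof. by move=> c0; apply: nnmfM; exact: nnmf_cst. Qed.

Lemma nnmf_indic A : measurable A -> nnmf \1_A.
Proof. by move=> mA; split. Qed.

Lemma nnmf_sum I (s : seq I) (f : I -> T -> R) : (forall i, nnmf (f i)) ->
  nnmf (fun w => \sum_(i <- s) f i w).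
Proof.
move=> mf; split; last by move=> w; apply: sumr_ge0 => i _; apply: (mf i).2.
by apply: measurable_sum => i; apply: (mf i).1.
Qed.

Lemma nnmf_prod I (s : seq I) (f : I -> T -> R) : (forall i, nnmf (f i)) ->
  nnmf (fun w => \prod_(i <- s) f i w).
Proof.
move=> mf; elim: s => [|i s IH].
  by under eq_fun do rewrite big_nil; exact: nnmf_cst.
by under eq_fun do rewrite big_cons; exact: nnmfM.
Qed.

Variable P : probability T R.

Definition Ex (f : T -> R) : \bar R := (\int[P]_w (f w)%:E)%E.
Definition pr (A : set T) : R := fine (P A).

Lemma prE A : measurable A -> P A = (pr A)%:E.
Proof. by move=> mA; rewrite fineK // fin_num_measure. Qed.

Lemma pr_ge0 A : 0 <= pr A.
Proof. exact: fine_ge0. Qed.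

Lemma pr_le A B : measurable A -> measurable B -> A `<=` B -> pr A <= pr B.
Proof. by move=> mA mB AB; rewrite -lee_fin -!prE // le_measure ?inE. Qed.

Lemma prT : pr setT = 1.
Proof. by rewrite /pr probability_setT. Qed.

Lemma pr_le1 A : measurable A -> pr A <= 1.
Proof. by move=> mA; rewrite -prT pr_le. Qed.

Lemma pr0 : pr set0 = 0.
Proof. by rewrite /pr measure0. Qed.

Lemma prU_le A B : measurable A -> measurable B -> pr (A `|` B) <= pr A + pr B.
Proof.
move=> mA mB; rewrite -lee_fin EFinD -!prE //; last exact: measurableU.
exact: measureU2.
Qed.

Lemma prD_setI A B : measurable A -> measurable B -> pr (A `&` ~` B) = pr A - pr (A `&` B).
Proof.
move=> mA mB; apply: (addIr (pr (A `&` B))); rewrite subrK.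
apply: EFin_inj; rewrite EFinD -!prE //; try by do ?apply: measurableI => //; apply: measurableC.
rewrite -measureU; last 3 first.
- by apply: measurableI => //; exact: measurableC.
- exact: measurableI.
- by apply/seteqP; split=> w //= [[_ ?] [_ ?]].
by rewrite setUC -setIUr setUv setIT.
Qed.

Lemma Ex_ge0 f : nnmf f -> (0 <= Ex f)%E.
Proof. by move=> [_ f0]; apply: integral_ge0 => w _; rewrite lee_fin. Qed.

Lemma eq_Ex f g : (forall w, f w = g w) -> Ex f = Ex g.
Proof. by move=> fg; congr Ex; apply/funext. Qed.

Lemma le_Ex f g : nnmf f -> nnmf g -> (forall w, f w <= g w) -> (Ex f <= Ex g)%E.
Proof.
move=> [mf f0] [mg g0] fg; apply: ge0_le_integral => //=.
- by move=> w _; rewrite lee_fin.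
- exact/measurable_EFinP.
- exact/measurable_EFinP.
- by move=> w _; rewrite lee_fin.
Qed.

Lemma ExD f g : nnmf f -> nnmf g -> Ex (fun w => f w + g w) = (Ex f + Ex g)%E.
Proof.
move=> [mf f0] [mg g0]; rewrite /Ex -ge0_integralD //.
- by move=> w _; rewrite lee_fin.
- exact/measurable_EFinP.
- by move=> w _; rewrite lee_fin.
- exact/measurable_EFinP.
Qed.

Lemma ExZ (c : R) f : 0 <= c -> nnmf f -> Ex (fun w => c * f w) = (c%:E * Ex f)%E.
Proof.
move=> c0 [mf f0]; rewrite /Ex -ge0_integralZl //.
- exact/measurable_EFinP.
- by move=> w _; rewrite lee_fin.
Qed.

Lemma Ex_indic A : measurable A -> Ex \1_A = (pr A)%:E.
Proof. by move=> mA; rewrite /Ex integral_indic // setIT; exact: prE. Qed.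

Lemma Ex_cst (c : R) : Ex (fun=> c) = c%:E.
Proof.
rewrite /Ex integral_cst // -[RHS]mule1; congr (_ * _)%E; exact: probability_setT.
Qed.

Lemma Ex_sum I (s : seq I) (f : I -> T -> R) : (forall i, nnmf (f i)) ->
  Ex (fun w => \sum_(i <- s) f i w) = (\sum_(i <- s) Ex (f i))%E.
Proof.
move=> mf; elim: s => [|i s IH].
  rewrite big_nil -[RHS]Ex_cst; apply: eq_Ex => w; exact: big_nil.
rewrite big_cons -IH -ExD //; last exact: nnmf_sum.
by apply: eq_Ex => w; rewrite big_cons.
Qed.

Lemma markov_le A f (c : R) : measurable A -> nnmf f -> 0 < c ->
  (forall w, A w -> c <= f w) -> ((c * pr A)%:E <= Ex f)%E.
Proof.
move=> mA mf c0 h; rewrite EFinM -Ex_indic // -ExZ ?(ltW c0) //.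
apply: le_Ex => //; first by apply: nnmfZ; [exact: ltW|exact: nnmf_indic].
move=> w; rewrite indicE; case: (boolP (w \in A)) => [/set_mem/h|_]; first by rewrite mulr1.
by rewrite mulr0 mf.2.
Qed.

Lemma Ex_nat_fibers (Y : T -> nat) f : drv Y -> nnmf f ->
  Ex f = (\sum_(0 <= n <oo) Ex (fun w => \1_(Y @^-1` [set n]) w * f w)%R)%E.
Proof.
move=> mY [mf f0]; pose F n := Y @^-1` [set n].
have UF : \bigcup_n F n = setT by apply/seteqP; split=> // w _; exists (Y w).
have tF : trivIset setT F by move=> i j _ _ [w [/= <- <-]].
rewrite {1}/Ex -UF ge0_integral_bigcup //.
- apply: eq_eseriesr => n _; rewrite /Ex integral_mkcond; apply: eq_integral => w _.
  rewrite /patch indicE; case: ifP => _; by rewrite ?mul1r ?mul0r.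
- by apply/measurable_EFinP; rewrite UF.
- by move=> w _; rewrite lee_fin.
Qed.

(** Plays the role of conditioning on Y. The fibres are numbered through [pickle]; a number that
    codes no value has an empty fibre and contributes 0 to both sides. *)
Lemma le_Ex_fibers (C : countType) (Y : T -> C) f g : drv Y -> nnmf f -> nnmf g ->
  (forall c, (Ex (fun w => \1_(Y @^-1` [set c]) w * f w)%R <=
              Ex (fun w => \1_(Y @^-1` [set c]) w * g w)%R)%E) ->
  (Ex f <= Ex g)%E.
Proof.
move=> mY mf mg h.
have mF := drv_comp pickle mY.
rewrite !(Ex_nat_fibers mF) //; apply: lee_nneseries => n *.
  by apply: Ex_ge0; apply: nnmfM => //; exact: nnmf_indic.
set F := _ @^-1` _.
case: (pselect (exists c : C, pickle c = n)) => [[c cn]|nc].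
  suff -> : F = Y @^-1` [set c] by exact: h.
  by apply/seteqP; split=> w; rewrite /F /= -cn; [move/(pcan_inj pickleK)|move=> ->].
suff -> : F = set0.
  have z e : Ex (fun w => \1_(@set0 T) w * e w) = 0%E.
    by rewrite -[RHS]Ex_cst; apply: eq_Ex => w; rewrite indic0 mul0r.
  by rewrite !z.
by apply/seteqP; split=> // w /= hw; apply: nc; exists (Y w).
Qed.

Lemma Ex_fiber (C : countType) (Y : T -> C) (h : C -> R) c : drv Y -> 0 <= h c ->
  Ex (fun w => \1_(Y @^-1` [set c]) w * h (Y w)) = (h c * pr (Y @^-1` [set c]))%:E.
Proof.
move=> mY hc; rewrite EFinM -Ex_indic // -ExZ //.
apply: eq_Ex => w; rewrite indicE mulrC.
by case: (boolP (w \in _)) => [/set_mem /= ->//|]; rewrite !mulr0.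
Qed.

Lemma Ex_fiber_indic (C : countType) (Y : T -> C) (A : set T) c : drv Y -> measurable A ->
  Ex (fun w => \1_(Y @^-1` [set c]) w * \1_A w) = (pr (Y @^-1` [set c] `&` A))%:E.
Proof.
move=> mY mA; rewrite -Ex_indic; last exact: measurableI.
by apply: eq_Ex => w; rewrite indicI.
Qed.

End Discrete.

(** * Events independent of a family of variables *)

Section Independence.
Context {d : measure_display} {T : measurableType d} {R : realType}.
Variables (P : probability T R) (I : eqType) (Y : I -> T -> nat).
Hypothesis mY : forall i, drv (Y i).
Local Notation pr := (pr P).
Local Notation Ex := (Ex P).

(* The event [E] is independent of the family [Y] restricted to [D], which is itself
   mutually independent. *)
Definition indep_of (E : set T) (D : pred I) := measurable E /\
  forall (s : seq I) (A : I -> set nat), uniq s -> all D s ->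
    pr (E `&` \big[setI/setT]_(i <- s) (Y i @^-1` A i))
    = pr E * \prod_(i <- s) pr (Y i @^-1` A i).

Lemma measurable_rect (s : seq I) (A : I -> set nat) :
  measurable (\big[setI/setT]_(i <- s) (Y i @^-1` A i)).
Proof. by apply: bigsetI_measurable => i _; apply: drv_preimage. Qed.

Lemma indep_of_sub E (D D' : pred I) : subpred D' D -> indep_of E D -> indep_of E D'.
Proof. by move=> DD [mE h]; split=> // s A us /(sub_all DD); exact: h. Qed.

Lemma indep_of1 E (D : pred I) i (B : set nat) : indep_of E D -> D i ->
  pr (E `&` Y i @^-1` B) = pr E * pr (Y i @^-1` B).
Proof.
move=> [mE h] Di; have := h [:: i] (fun=> B).
by rewrite !big_seq1 /= Di => ->.
Qed.

(** A condition on the i-th variable may be absorbed into the event, provided that i leaves the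
    family: independence is applied to the list [i :: s]. *)
Lemma indep_of_setI E (D : pred I) i (B : set nat) : indep_of E D -> D i ->
  indep_of (E `&` Y i @^-1` B) [pred j | (j != i) && D j].
Proof.
move=> hE Di; split; first by apply: measurableI; [exact: hE.1|exact: drv_preimage].
move=> s A us Ds; rewrite (indep_of1 _ hE) //.
have := hE.2 (i :: s) (fun j => if j == i then B else A j).
have is_ : i \notin s by apply/negP => /(allP Ds) /=; rewrite eqxx.
rewrite !big_cons /= eqxx is_ us /= Di /= setIA mulrA.
rewrite (@eq_big_seq _ _ _ _ s _ (fun j => Y j @^-1` A j)); last first.
  by move=> j js; case: eqP => // ji; move: is_; rewrite -ji js.
rewrite (@eq_big_seq _ _ _ _ s _ (fun j => pr (Y j @^-1` A j))); last first.
  by move=> j js; case: eqP => // ji; move: is_; rewrite -ji js.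
by apply=> //; apply/allP => j /(allP Ds) /andP[].
Qed.

Lemma indep_of_bigcup (F : nat -> set T) (D : pred I) : trivIset setT F ->
  (forall n, indep_of (F n) D) -> indep_of (\bigcup_n F n) D.
Proof.
move=> tF hF; have mU : measurable (\bigcup_n F n).
  by apply: bigcup_measurable => n _; exact: (hF n).1.
split=> // s A us Ds; apply: EFin_inj.
rewrite EFinM -!prE //; last by apply: measurableI => //; exact: measurable_rect.
rewrite setI_bigcupl !measure_bigcup //; last 3 first.
- by move=> n _; exact: (hF n).1.
- by move=> n _; apply: measurableI; [exact: (hF n).1|exact: measurable_rect].
- by apply: trivIset_setIr.
rewrite muleC -nneseriesZl; last by move=> n _; exact: measure_ge0.
apply: eq_eseriesr => n _.
rewrite -[X in _ = (_ * X)%E](esym (prE P (hF n).1)) -EFinM mulrC -(hF n).2 //.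
by apply: prE; apply: measurableI; [exact: (hF n).1|exact: measurable_rect].
Qed.

(** Splitting over the value k of the first variable reduces to the shorter list; the accumulator
    [c] records the values already fixed. In this way the event that fixes the next generation stays
    independent of the variables not yet used. *)
Lemma indep_of_sum E (D : pred I) (l : seq I) (c z : nat) :
  uniq l -> all D l -> indep_of E D ->
  indep_of (E `&` [set w | (c + \sum_(i <- l) Y i w)%N = z]) [pred j | (j \notin l) && D j].
Proof.
elim: l E D c => [|i l IH] E D c /=.
  move=> _ _ hE; have [cz|cz] := eqVneq c z.
    rewrite (_ : [set _ | _] = setT) ?setIT; first exact: indep_of_sub hE.
    by apply/seteqP; split=> // w _ /=; rewrite big_nil addn0.
  rewrite (_ : [set _ | _] = set0) ?setI0; last first.
    by apply/seteqP; split=> // w /=; rewrite big_nil addn0 => /eqP; rewrite (negPf cz).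
  by split=> // s A _ _; rewrite set0I pr0 mul0r.
move=> /andP[il ul] /andP[Di Dl] hE.
have -> : E `&` [set w | (c + \sum_(j <- i :: l) Y j w)%N = z] =
  \bigcup_k ((E `&` Y i @^-1` [set k]) `&` [set w | ((c + k) + \sum_(j <- l) Y j w)%N = z]).
  apply/seteqP; split=> w /=.
    by move=> [Ew]; rewrite big_cons addnA => h; exists (Y i w).
  by move=> [k _ [[Ew /= <-] h]]; split=> //; rewrite big_cons addnA.
apply: indep_of_bigcup.
  by apply: (@sub_trivIset _ _ _ setT) => // a b _ _ [w [[[_ /= <-] _] [[_ /= <-] _]]].
move=> k; apply: indep_of_sub (IH _ _ (c + k)%N ul _ (indep_of_setI [set k] hE Di)).
  by move=> j /=; rewrite inE negb_or => /andP[/andP[-> ->] ->].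
apply/allP => j jl /=; rewrite (allP Dl) // andbT.
by apply: contraNneq il => <-.
Qed.

(** On the fibre of the first variable its factor is constant, and the intersection of E with that
    fibre is independent of the other variables. The induction therefore has to let the event
    vary. *)
Lemma Ex_prod E (D : pred I) (l : seq I) (h : I -> nat -> R) (e : I -> R) :
  (forall i k, 0 <= h i k) -> uniq l -> all D l -> indep_of E D ->
  (forall i, i \in l -> Ex (fun w => h i (Y i w)) = (e i)%:E) ->
  Ex (fun w => \1_E w * \prod_(i <- l) h i (Y i w)) = (pr E * \prod_(i <- l) e i)%:E.
Proof.
move=> h0; have hm i : nnmf (fun w => h i (Y i w)) by exact: nnmf_drv.
elim: l E D => [|i l IH] E D /=.
  move=> _ _ hE _; rewrite big_nil mulr1 -Ex_indic; last exact: hE.1.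
  by apply: eq_Ex => w; rewrite big_nil mulr1.
move=> /andP[il ul] /andP[Di Dl] hE he.
have he' j : j \in l -> Ex (fun w => h j (Y j w)) = (e j)%:E.
  by move=> jl; apply: he; rewrite inE jl orbT.
have e0 j : j \in i :: l -> 0 <= e j.
  by move=> jl; rewrite -lee_fin -he //; apply: Ex_ge0.
pose K := pr E * \prod_(j <- l) e j.
have K0 : 0 <= K.
  rewrite mulr_ge0 ?pr_ge0 // big_seq prodr_ge0 // => j jl.
  by apply: e0; rewrite inE jl orbT.
have mf1 : nnmf (fun w => \1_E w * \prod_(j <- i :: l) h j (Y j w)).
  by apply: nnmfM; [apply: nnmf_indic; exact: hE.1|exact: nnmf_prod].
have mf2 : nnmf (fun w => K * h i (Y i w)) by exact: nnmfZ.
have fib c : Ex (fun w => \1_(Y i @^-1` [set c]) w * (\1_E w * \prod_(j <- i :: l) h j (Y j w)))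
    = Ex (fun w => \1_(Y i @^-1` [set c]) w * (K * h i (Y i w))).
  rewrite (@Ex_fiber _ _ _ P _ (Y i) (fun c => K * h i c)) //; last by rewrite mulr_ge0.
  have hE' := indep_of_setI [set c] hE Di.
  have := IH _ _ ul _ hE' he'.
  rewrite (indep_of1 _ hE Di) => IH'.
  transitivity (Ex (fun w => h i c * (\1_(E `&` Y i @^-1` [set c]) w * \prod_(j <- l) h j (Y j w)))).
    apply: eq_Ex => w; rewrite big_cons indicI [X in X * _ * _]indicE !mulrA /=.
    rewrite [\1_(Y i @^-1` _) w]indicE.
    case: (boolP (w \in Y i @^-1` [set c])) => [/set_mem /= ->|_]; last by rewrite !(mul0r,mulr0).
    by rewrite indicE; ring.
  rewrite ExZ //; last by apply: nnmfM; [apply: nnmf_indic; exact: hE'.1|exact: nnmf_prod].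
  rewrite IH' //; first by rewrite -EFinM /K; congr (_%:E); ring.
  apply/allP => j jl /=; rewrite (allP Dl) // andbT.
  by apply: contraNneq il => <-.
transitivity (Ex (fun w => K * h i (Y i w))).
  by apply/eqP; rewrite eq_le; apply/andP; split; apply: (le_Ex_fibers (mY i)) => // c; rewrite fib.
rewrite ExZ // he ?mem_head // big_cons -EFinM /K; congr (_%:E); ring.
Qed.

End Independence.

(** * Exponential moments *)

Section ExpBounds.
Context {R : realType}.
Implicit Types (s y z B : R).

(** The usual remainder y^2 would require a second moment. With y = s X, the remainder y min(1, y)
    has mean s times E[X min(1, s X)], which is o(s) as soon as X is integrable. *)
Lemma expR_le_quad y B : 0 <= y <= B ->
  expR y <= 1 + y + expR B * (y * Num.min 1 y).
Proof.
move=> /andP[y0 yB].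
have e1 : expR y * (1 - y) <= 1.
  have := ler_wpM2l (expR_ge0 y) (expR_ge1Dx (- y)).
  by rewrite -expRD subrr expR0.
have eB : expR y <= expR B by rewrite ler_expR.
have e0 := expR_gt0 y.
have : expR y - 1 <= expR B * Num.min 1 y.
  case: (lerP 1 y) => h; first by rewrite mulr1; lra.
  by apply: le_trans (ler_wpM2r y0 eB); lra.
by move=> /(ler_wpM2l y0); lra.
Qed.

(** Below 1 this is exp(-y) <= 1 / (1 + y) <= 1 - y + y^2. It serves twice: for lower deviations,
    and to bound the probability that no summand is large. *)
Lemma expRN_le y : 0 <= y -> expR (- y) <= 1 - y + y * Num.min 1 y.
Proof.
move=> y0; case: (lerP 1 y) => h.
  by rewrite mulr1 subrK -[leRHS]expR0 ler_expR; lra.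
rewrite expRN; apply: le_trans (_ : (1 + y)^-1 <= _).
  by rewrite lef_pV2 ?posrE ?expR_gt0 ?expR_ge1Dx //; lra.
have y1 : 0 < 1 + y by lra.
rewrite -[leLHS]mul1r ler_pdivrMr //.
have : 0 <= y * y * y by rewrite !mulr_ge0.
lra.
Qed.

(** Convexity: the tangent of the exponential at z lies below it at 0 and at y, and the two
    inequalities are averaged with weights 1 - z / y and z / y. The sign of s does not matter. *)
Lemma expR_chord s y z : 0 < y -> 0 <= z <= y ->
  expR (s * z) <= 1 + z * (expR (s * y) / y).
Proof.
move=> y0 /andP[z0 zy].
have zy1 : z / y <= 1 by rewrite ler_pdivrMr // mul1r.
have zy0 : 0 <= z / y by rewrite divr_ge0 // ltW.
have h1 : expR (s * z) * (1 - s * z) <= 1.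
  have := ler_wpM2l (expR_ge0 (s * z)) (expR_ge1Dx (- (s * z))).
  by rewrite -expRD subrr expR0.
have h2 : expR (s * z) * (1 + s * (y - z)) <= expR (s * y).
  have := ler_wpM2l (expR_ge0 (s * z)) (expR_ge1Dx (s * (y - z))).
  by rewrite -expRD -mulrDr subrKC.
have h1' : (1 - z / y) * (expR (s * z) * (1 - s * z)) <= 1 - z / y.
  by rewrite -[leRHS]mulr1 ler_wpM2l // subr_ge0.
have h2' := ler_wpM2l zy0 h2.
have -> : z * (expR (s * y) / y) = z / y * expR (s * y) by ring.
have id : expR (s * z) = (1 - z / y) * (expR (s * z) * (1 - s * z)) +
   z / y * (expR (s * z) * (1 + s * (y - z))).
  by field; rewrite gt_eqF.
rewrite id; lra.
Qed.

End ExpBounds.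

Section Moments.
Context {d : measure_display} {T : measurableType d} {R : realType}.
Variable P : probability T R.
Local Notation Ex := (Ex P).

(** Dominated convergence along s = 1 / (n + 1), extended to all smaller s by monotonicity. This is
    what replaces a second moment in the weak law. *)
Lemma trunc_small (C : countType) (Y : T -> C) (h : C -> R) (e : R) :
  drv Y -> (forall c, 0 <= h c) -> (Ex (fun w => h (Y w)) < +oo)%E -> 0 < e ->
  exists2 s0 : R, 0 < s0 & forall s, 0 <= s <= s0 ->
    (Ex (fun w => h (Y w) * Num.min 1 (s * h (Y w)))%R <= e%:E)%E.
Proof.
move=> mY h0 fin e0.
pose f n w := h (Y w) * Num.min 1 (n.+1%:R^-1 * h (Y w)).
have min0 s w : 0 <= s -> 0 <= Num.min 1 (s * h (Y w)).
  by move=> s0; rewrite le_min ler01 mulr_ge0.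
have nf s : 0 <= s -> nnmf (fun w => h (Y w) * Num.min 1 (s * h (Y w))).
  move=> s0; apply: (nnmf_drv (h := fun c => h c * Num.min 1 (s * h c))) => // c.
  by rewrite mulr_ge0 // le_min ler01 mulr_ge0.
have nh : nnmf (fun w => h (Y w)) by apply: nnmf_drv.
have := @dominated_convergence _ T R P setT measurableT
  (fun n w => (f n w)%:E) (cst 0%E) (fun w => (h (Y w))%:E).
case.
- by move=> n; apply/measurable_EFinP; apply: (nf _ _).1.
- exact: measurable_cst.
- apply: aeW => w _ /=; apply: cvg_EFin; first by apply: nearW.
  rewrite [X in _ --> X](_ : _ = h (Y w) * (0 * h (Y w))); last by rewrite mul0r mulr0.
  apply: (@squeeze_cvgr _ _ _ _ (fun=> 0) (fun n => h (Y w) * (n.+1%:R^-1 * h (Y w)))).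
  + near=> n; rewrite mulr_ge0 //=; last by rewrite min0.
    by rewrite ler_wpM2l // ge_min lexx orbT.
  + by rewrite mul0r mulr0; exact: cvg_cst.
  + by apply: cvgM; [exact: cvg_cst|apply: cvgM; [exact: cvg_harmonic|exact: cvg_cst]].
- apply/integrableP; split; first exact/measurable_EFinP/nh.1.
  rewrite (eq_integral (fun w => (h (Y w))%:E)) // => w _.
  by rewrite gee0_abs // lee_fin.
- apply: aeW => w n _ /=; rewrite ger0_norm ?mulr_ge0 // ?min0 //.
  by rewrite lee_fin ler_piMr // ge_min lexx.
move=> _ _; rewrite integral_cst // mul0e => /fine_cvgP[[N1 _ hN1]].
move=> /cvgrPdist_le/(_ _ e0)[N2 _ hN2].
pose n := maxn N1 N2; exists n.+1%:R^-1; first by rewrite invr_gt0.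
move=> s /andP[s0 sn]; apply: le_trans (_ : Ex (f n) <= _)%E.
  apply: le_Ex; [exact: nf|by apply: nf|move=> w].
  rewrite ler_wpM2l // le_min ge_min lexx /= ge_min.
  by apply/orP; right; rewrite ler_wpM2r.
have fn : Ex (f n) \is a fin_num by apply: hN1; rewrite /= leq_maxl.
have := hN2 n (leq_maxr _ _); rewrite /= sub0r normrN => hn.
by rewrite -(fineK fn) lee_fin; apply: le_trans hn; exact: ler_norm.
Unshelve. all: by end_near. Qed.

Section Mgf.
Variables (X : T -> nat) (m j s : R).
Hypothesis mX : drv X.
Hypothesis EX : Ex (fun w => (X w)%:R) = m%:E.
Hypothesis s0 : 0 <= s.
Hypothesis jX : (Ex (fun w => (X w)%:R * Num.min 1 (s * (X w)%:R))%R <= j%:E)%E.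

Let nX (h : nat -> R) : (forall k, 0 <= h k) -> nnmf (fun w => h (X w)).
Proof. by move=> h0; apply: nnmf_drv. Qed.

Let nXid : nnmf (fun w => (X w)%:R : R).
Proof. exact: (nX (h := fun k => k%:R)). Qed.

Let nXmin : nnmf (fun w => (X w)%:R * Num.min 1 (s * (X w)%:R)).
Proof.
by apply: (nX (h := fun k => k%:R * Num.min 1 (s * k%:R))) => k; rewrite mulr_ge0 // le_min ler01 mulr_ge0.
Qed.

Let m0 : 0 <= m.
Proof. by rewrite -lee_fin -EX; apply: Ex_ge0. Qed.

Lemma mgf_trunc_le (y : R) :
  (Ex (fun w => ((X w)%:R <= y)%R%:R * expR (s * (X w)%:R))%R <=
   (expR (s * (m + expR (s * y) * j)))%:E)%E.
Proof.
have c0 : 0 <= expR (s * y) * s by rewrite mulr_ge0 // expR_ge0.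
apply: le_trans (_ : Ex (fun w => (1 + s * (X w)%:R) +
   expR (s * y) * s * ((X w)%:R * Num.min 1 (s * (X w)%:R)))%R <= _)%E.
  apply: le_Ex.
  - by apply: (nX (h := fun k => ((k%:R <= y)%R%:R * expR (s * k%:R)))) => k; rewrite mulr_ge0 // expR_ge0.
  - apply: nnmfD; first by apply: nnmfD; [exact: nnmf_cst|exact: nnmfZ].
    exact: nnmfZ.
  - move=> w; case: (lerP (X w)%:R y) => h; last first.
      rewrite mul0r addr_ge0 ?mulr_ge0 ?addr_ge0 ?mulr_ge0 ?expR_ge0 //.
      by rewrite le_min ler01 mulr_ge0.
    rewrite mul1r; apply: le_trans (expR_le_quad (B := s * y) _) _.
      by rewrite mulr_ge0 //= ler_wpM2l.
    by rewrite !mulrA lexx.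
rewrite ExD; last 2 first.
- by apply: nnmfD; [exact: nnmf_cst|exact: nnmfZ].
- exact: nnmfZ.
rewrite ExD; [|exact: nnmf_cst|exact: nnmfZ].
rewrite Ex_cst ExZ // EX ExZ //.
apply: le_trans (_ : 1%:E + s%:E * m%:E + (expR (s * y) * s)%:E * j%:E <= _)%E.
  by rewrite leeD2l // lee_wpmul2l // lee_fin.
rewrite -!EFinM -!EFinD lee_fin; apply: le_trans (expR_ge1Dx _); lra.
Qed.

Lemma mgf_neg_le :
  (Ex (fun w => expR (- s * (X w)%:R)) <= (expR (- s * (m - j)))%:E)%E.
Proof.
have ne : nnmf (fun w => expR (- s * (X w)%:R)).
  by apply: (nX (h := fun k => expR (- s * k%:R))) => k; exact: expR_ge0.
(* The linear term is added on the left instead of subtracted on the right, so that only nonnegative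
   functions are integrated. *)
have : (Ex (fun w => expR (- s * (X w)%:R) + s * (X w)%:R)%R <=
        Ex (fun w => 1 + s * ((X w)%:R * Num.min 1 (s * (X w)%:R)))%R)%E.
  apply: le_Ex.
  - by apply: nnmfD => //; exact: nnmfZ.
  - by apply: nnmfD; [exact: nnmf_cst|exact: nnmfZ].
  - move=> w; have := @expRN_le R (s * (X w)%:R); rewrite mulr_ge0 // => /(_ isT).
    by rewrite mulNr; lra.
rewrite ExD //; last exact: nnmfZ.
rewrite ExD; [|exact: nnmf_cst|exact: nnmfZ].
rewrite Ex_cst !ExZ // EX => h.
have {h} : (Ex (fun w => expR (- s * (X w)%:R)) + (s * m)%:E <= (1 + s * j)%:E)%E.
  apply: le_trans h _; rewrite EFinD EFinM leeD2l // lee_wpmul2l // lee_fin //.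
have := Ex_ge0 P ne; case: (Ex _) => [x||] //=.
rewrite -EFinD !lee_fin => _ h; apply: le_trans (expR_ge1Dx _); lra.
Qed.

(** Only the mean and the truncation level enter, and s need not be small. Thus s may grow with the
    ratio of x to the number of summands, as Bennett's bound requires. *)
Lemma mgf_chord_le (y : R) : 0 < y ->
  (Ex (fun w => ((X w)%:R <= y)%R%:R * expR (s * (X w)%:R))%R <=
   (expR (m * (expR (s * y) / y)))%:E)%E.
Proof.
move=> y0; have c0 : 0 <= expR (s * y) / y by rewrite divr_ge0 ?expR_ge0 // ltW.
apply: le_trans (_ : Ex (fun w => 1 + expR (s * y) / y * (X w)%:R)%R <= _)%E.
  apply: le_Ex.
  - by apply: (nX (h := fun k => ((k%:R <= y)%R%:R * expR (s * k%:R)))) => k; rewrite mulr_ge0 // expR_ge0.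
  - by apply: nnmfD; [exact: nnmf_cst|exact: nnmfZ].
  - move=> w; case: (lerP (X w)%:R y) => h; last first.
      by rewrite mul0r addr_ge0 // mulr_ge0.
    by rewrite mul1r [in leRHS]mulrC; apply: expR_chord => //; rewrite ler0n.
rewrite ExD; [|exact: nnmf_cst|exact: nnmfZ].
rewrite Ex_cst ExZ // EX -EFinM -EFinD lee_fin.
by apply: le_trans (expR_ge1Dx _); rewrite mulrC.
Qed.

End Mgf.
End Moments.

(** * Sums of independent variables *)

Section Events.
Context {d : measure_display} {T : measurableType d} {R : realType}.
Variable P : probability T R.

Lemma drv_cst (C : countType) (c : C) : drv (fun _ : T => c).
Proof. by move=> c'; rewrite preimage_cst; case: ifP. Qed.

Lemma exists2_cons (I : eqType) (i : I) (s : seq I) (p : I -> T -> Prop) :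
  [set w | exists2 j, j \in i :: s & p j w] =
  [set w | p i w] `|` [set w | exists2 j, j \in s & p j w].
Proof.
apply/seteqP; split=> w /=.
  by move=> [j]; rewrite inE => /orP[/eqP ->|js] pj; [left|right; exists j].
by case=> [pi|[j js pj]]; [exists i|exists j]; rewrite // inE ?eqxx ?js ?orbT.
Qed.

Lemma exists2_nil (I : eqType) (p : I -> T -> Prop) :
  [set w | exists2 j, j \in [::] & p j w] = set0.
Proof. by apply/seteqP; split=> // w [j]. Qed.

Lemma bigsetIE (I : eqType) (s : seq I) (F : I -> set T) w :
  (\big[setI/setT]_(i <- s) F i) w <-> forall i, i \in s -> F i w.
Proof.
elim: s => [|i s IH]; first by rewrite big_nil.
rewrite big_cons; split=> [[Fi /IH Fs] j|h].
  by rewrite inE => /orP[/eqP ->|/Fs].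
split; first by apply: h; rewrite mem_head.
by apply/IH => j js; apply: h; rewrite inE js orbT.
Qed.

Lemma measurable_exists2 (I : eqType) (s : seq I) (p : I -> T -> Prop) :
  (forall i, measurable [set w | p i w]) -> measurable [set w | exists2 i, i \in s & p i w].
Proof.
move=> mp; elim: s => [|i s IH]; first by rewrite exists2_nil.
by rewrite exists2_cons; exact: measurableU.
Qed.

Lemma pr_exists2_le (I : eqType) (s : seq I) (p : I -> T -> Prop) :
  (forall i, measurable [set w | p i w]) ->
  pr P [set w | exists2 i, i \in s & p i w] <= \sum_(i <- s) pr P [set w | p i w].
Proof.
move=> mp; elim: s => [|i s IH]; first by rewrite exists2_nil pr0 big_nil.
rewrite exists2_cons big_cons; apply: le_trans (prU_le _ _ _) _ => //.
  exact: measurable_exists2.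
by rewrite lerD2l.
Qed.

Lemma measurable_drv (C : countType) (Z : T -> C) (p : C -> Prop) :
  drv Z -> measurable [set w | p (Z w)].
Proof. by move=> mZ; apply: (drv_preimage [set c | p c]). Qed.

End Events.

Section ListBounds.
Context {d : measure_display} {T : measurableType d} {R : realType}.
Variables (P : probability T R) (I : eqType) (Y : I -> T -> nat).
Hypothesis mY : forall i, drv (Y i).
Local Notation pr := (pr P).
Local Notation Ex := (Ex P).
Variables (E : set T) (D : pred I) (l : seq I).
Hypothesis ul : uniq l.
Hypothesis Dl : all D l.
Hypothesis hE : indep_of P Y E D.

Lemma drv_sum (s : seq I) (p : pred I) : drv (fun w => \sum_(i <- s | p i) Y i w)%N.
Proof.
elim: s => [|i s IH]; first by under eq_fun do rewrite big_nil; exact: drv_cst.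
under eq_fun do rewrite big_cons; case: (p i) => //.
exact: (drv_comp (fun q => q.1 + q.2)%N (drv_pair (mY i) IH)).
Qed.

Lemma drv_all (s : seq I) (B : nat -> bool) : drv (fun w => all (fun i => B (Y i w)) s).
Proof.
elim: s => [|i s IH] /=; first exact: drv_cst.
exact: (drv_comp (fun q => B q.1 && q.2) (drv_pair (mY i) IH)).
Qed.

Lemma indep_of_pr i (B : nat -> Prop) : i \in l ->
  pr (E `&` [set w | B (Y i w)]) = pr E * pr [set w | B (Y i w)].
Proof. by move=> il; apply: (indep_of1 [set k | B k] hE (allP Dl _ il)). Qed.

(** Markov's inequality for the exponential of the sum. The factor s is kept on both sides of the
    deviation because s is negative for lower deviations; [B] is the truncation, trivial in that
    case. *)
Lemma chernoff_sum (B : nat -> bool) (s z : R) (a : I -> R) :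
  (forall i, i \in l ->
    (Ex (fun w => (B (Y i w))%:R * expR (s * (Y i w)%:R))%R <= (expR (a i))%:E)%E) ->
  pr (E `&` [set w | all (fun i => B (Y i w)) l /\ s * z <= s * (\sum_(i <- l) Y i w)%:R])
    <= pr E * expR (\sum_(i <- l) a i - s * z).
Proof.
move=> ha; pose h (i : I) k := (B k)%:R * expR (s * k%:R).
have h0 i k : 0 <= h i k by rewrite mulr_ge0 // expR_ge0.
have nh i : nnmf (fun w => h i (Y i w)) by apply: nnmf_drv.
have mE := hE.1.
pose e i := fine (Ex (fun w => h i (Y i w))).
have eE i : i \in l -> Ex (fun w => h i (Y i w)) = (e i)%:E.
  move=> il; rewrite fineK // ge0_fin_numE; last exact: Ex_ge0.
  exact: le_lt_trans (ha i il) (ltry _).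
have e_le i : i \in l -> 0 <= e i <= expR (a i).
  by move=> il; rewrite -!lee_fin -eE // ha // Ex_ge0.
set A := E `&` _.
have mA : measurable A.
  apply: measurableI => //.
  exact: (measurable_drv (fun q : bool * nat => q.1 /\ s * z <= s * q.2%:R) (drv_pair (drv_all l B) (drv_sum l xpredT))).
have : ((expR (s * z) * pr A)%:E <= Ex (fun w => \1_E w * \prod_(i <- l) h i (Y i w))%R)%E.
  apply: markov_le => //; last 2 first.
  - exact: expR_gt0.
  - move=> w [Ew [/allP Bw hz]]; rewrite indicE mem_set // mul1r.
    rewrite (_ : \prod_(i <- l) _ = expR (s * (\sum_(i <- l) Y i w)%:R)); first by rewrite ler_expR.
    rewrite natr_sum mulr_sumr expR_sum; apply: eq_big_seq => i il.
    by rewrite /h Bw // mul1r.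
  - by apply: nnmfM; [exact: nnmf_indic|exact: nnmf_prod].
rewrite (Ex_prod mY h0 ul Dl hE eE) lee_fin.
rewrite expRD expRN mulrA ler_pdivlMr ?expR_gt0 // mulrC => /le_trans; apply.
rewrite ler_wpM2l ?pr_ge0 // expR_sum big_seq [leRHS]big_seq.
by apply: ler_prod => i /e_le.
Qed.

Let mtail i (y : R) : measurable [set w | y < (Y i w)%:R].
Proof. exact: (measurable_drv (fun k => y < k%:R)). Qed.

Lemma pr_jump_le (y : R) :
  pr (E `&` [set w | exists2 i, i \in l & y < (Y i w)%:R])
    <= pr E * \sum_(i <- l) tailP P (Y i) y.
Proof.
have mE := hE.1.
rewrite (_ : E `&` _ = [set w | exists2 i, i \in l & E w /\ y < (Y i w)%:R]); last first.
  by apply/seteqP; split=> [w [Ew [i il yi]]|w [i il [Ew yi]]]; [exists i|split=> //; exists i].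
have mp i : measurable (E `&` [set w | y < (Y i w)%:R]) by exact: measurableI.
apply: le_trans (pr_exists2_le P l mp) _.
rewrite mulr_sumr big_seq [leRHS]big_seq; apply: ler_sum => i il.
by rewrite (indep_of_pr (fun k => y < k%:R) il).
Qed.

(* Markov's inequality for the sum of the others, on the event that Y_i is large. *)
Lemma pr_two_jumps_le (y c c' : R) (m : I -> R) : 0 <= c -> 0 < c' ->
  (forall i, i \in l -> Ex (fun w => (Y i w)%:R) = (m i)%:E) ->
  pr (E `&` [set w | exists2 i, i \in l & y < (Y i w)%:R /\
        c' <= (\sum_(j <- l | j != i) Y j w)%:R + c])
    <= pr E * \sum_(i <- l) (tailP P (Y i) y * Num.min 1 ((\sum_(j <- l) m j + c) / c')).
Proof.
move=> c0 c'0 hm; have mE := hE.1.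
have m0 i : i \in l -> 0 <= m i.
  move=> il; rewrite -lee_fin -hm //; apply: Ex_ge0.
  exact: (nnmf_drv (h := fun k => k%:R)).
pose p i w := y < (Y i w)%:R /\ c' <= (\sum_(j <- l | j != i) Y j w)%:R + c.
have mp i : measurable (E `&` [set w | p i w]).
  apply: measurableI => //.
  exact: (measurable_drv (fun q : nat * nat => y < q.1%:R /\ c' <= q.2%:R + c)
    (drv_pair (mY i) (drv_sum l (fun j => j != i)))).
rewrite (_ : E `&` _ = [set w | exists2 i, i \in l & E w /\ p i w]); last first.
  by apply/seteqP; split=> [w [Ew [i il yi]]|w [i il [Ew yi]]]; [exists i|split=> //; exists i].
apply: le_trans (pr_exists2_le P l mp) _.
rewrite mulr_sumr big_seq [leRHS]big_seq; apply: ler_sum => i il.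
pose E' := E `&` [set w | y < (Y i w)%:R].
have mE' : measurable E' by exact: measurableI.
have hE' : indep_of P Y E' [pred j | (j != i) && D j].
  exact: (indep_of_setI mY [set k | y < k%:R] hE (allP Dl _ il)).
have prE' : pr E' = pr E * tailP P (Y i) y.
  by rewrite /E' (indep_of_pr (fun k => y < k%:R) il).
rewrite mulrA -prE' minr_pMr ?pr_ge0 // le_min mulr1; apply/andP; split.
  by apply: pr_le => [|//|w [Ew [yw _]]]; [exact: (mp i)|split].
rewrite mulrA ler_pdivlMr // mulrC.
have nid j : nnmf (fun w => (Y j w)%:R : R) by exact: (nnmf_drv (h := fun k => k%:R)).
have nf : nnmf (fun w => \sum_(j <- [seq j <- l | j != i]) (\1_E' w * (Y j w)%:R) + c * \1_E' w).
  apply: nnmfD; last by apply: nnmfZ => //; exact: nnmf_indic.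
  by apply: nnmf_sum => j; apply: nnmfM => //; exact: nnmf_indic.
have := @markov_le _ _ _ P _ _ c' (mp i) nf c'0.
rewrite ExD; last 2 first.
- by apply: nnmf_sum => j; apply: nnmfM => //; exact: nnmf_indic.
- by apply: nnmfZ => //; exact: nnmf_indic.
rewrite Ex_sum; last by move=> j; apply: nnmfM => //; exact: nnmf_indic.
rewrite ExZ ?Ex_indic //.
rewrite (@eq_big_seq _ _ _ _ _ _ (fun j => (pr E' * m j)%:E)); last first.
  move=> j; rewrite mem_filter => /andP[ji jl].
  have := @Ex_prod _ _ _ P _ Y mY E' _ [:: j] (fun _ k => k%:R) m _ isT _ hE'.
  rewrite !big_seq1 => <- //.
  - by apply: eq_Ex => w; rewrite big_seq1.
  - by rewrite /= ji (allP Dl).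
  - by move=> k; rewrite inE => /eqP ->; rewrite hm.
rewrite sumEFin -EFinM -EFinD lee_fin => h.
apply: le_trans (h _) _.
  move=> w [Ew [yw hw]]; rewrite !indicE mem_set //= mulr1.
  rewrite (eq_bigr (fun j => (Y j w)%:R)); last by move=> j _; rewrite mul1r.
  by rewrite -natr_sum big_filter.
rewrite -mulr_sumr [c * _]mulrC -mulrDr ler_wpM2l ?pr_ge0 // lerD2r.
rewrite big_filter big_seq_cond [leRHS]big_seq [leRHS](bigID (fun j => j != i)) /=.
by rewrite lerDl sumr_ge0 // => j /andP[/m0].
Qed.

(** From 1 - p <= exp(-p) the product is at most exp(-t), to which [expRN_le] applies. *)
Lemma prod_compl_le (p : I -> R) (t : R) : (forall i, 0 <= p i <= 1) ->
  t = \sum_(i <- l) p i -> \prod_(i <- l) (1 - p i) <= 1 - t + t * Num.min 1 t.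
Proof.
move=> hp tE; have t0 : 0 <= t by rewrite tE;  apply: sumr_ge0 => i _; case/andP: (hp i).
apply: le_trans (expRN_le t0); rewrite {1}tE -sumrN expR_sum.
apply: ler_prod => i _; have /andP[? ?] := hp i.
by rewrite subr_ge0; apply/andP; split=> //; exact: expR_ge1Dx.
Qed.

(** By independence the probability of no jump is a product, so no pairs of jumps need to be
    enumerated: t min(1, t) is the price of counting several jumps more than once. *)
Lemma pr_jump_ge (y t : R) : t = \sum_(i <- l) tailP P (Y i) y ->
  pr E * (t - t * Num.min 1 t)
    <= pr (E `&` [set w | exists2 i, i \in l & y < (Y i w)%:R]).
Proof.
move=> tE; have mE := hE.1.
have mH : measurable [set w | exists2 i, i \in l & y < (Y i w)%:R].
  by apply: measurable_exists2.
have key : pr (E `&` ~` [set w | exists2 i, i \in l & y < (Y i w)%:R]) =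
   pr E * \prod_(i <- l) (1 - tailP P (Y i) y).
  rewrite (_ : E `&` _ = E `&` \big[setI/setT]_(i <- l) (Y i @^-1` [set k | ~ y < k%:R])); last first.
    congr (_ `&` _); apply/seteqP; split=> w.
      by move=> h; apply/bigsetIE => i il hi; apply: h; exists i.
    by move/bigsetIE=> h [i il hi]; exact: (h i il).
  rewrite hE.2 //; congr (_ * _); apply: eq_bigr => i _.
  have := @prD_setI _ _ _ P setT _ measurableT (mtail i y).
  by rewrite !setTI prT.
have := prD_setI P mE mH; rewrite key => h.
have hp i : 0 <= tailP P (Y i) y <= 1.
  by apply/andP; split; [exact: pr_ge0|exact: pr_le1].
have := ler_wpM2l (pr_ge0 P E) (prod_compl_le hp tE); lra.
Qed.

End ListBounds.

(** * Bounds conditional on the random numbers of summands *)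

Section Conditional.
Context {d : measure_display} {T : measurableType d} {R : realType}.
Variables (P : probability T R) (I : eqType) (Y : I -> T -> nat).
Hypothesis mY : forall i, drv (Y i).
Local Notation pr := (pr P).
Local Notation Ex := (Ex P).
Variables (E : nat * nat -> set T) (l : nat * nat -> seq I) (m : I -> R).
Variables (m1 m2 m3 mbar b : R) (p1 p2 p3 : R -> R).
Hypothesis ul : forall q, uniq (l q).
Hypothesis hE : forall q, indep_of P Y (E q) (mem (l q)).
Hypothesis size_l : forall q, size (l q) = (q.1 + q.2).+1.
Hypothesis Em : forall q i, i \in l q -> Ex (fun w => (Y i w)%:R) = (m i)%:E.
Hypothesis m_le : forall q i, i \in l q -> 0 <= m i <= mbar.
Hypothesis sum_m : forall q, \sum_(i <- l q) m i = m1 * q.2%:R + m2 * q.1%:R + m3.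
Hypothesis sum_tail : forall q y, \sum_(i <- l q) tailP P (Y i) y
  = p1 y * q.2%:R + p2 y * q.1%:R + p3 y.
Hypothesis unif : forall j, 0 < j -> exists2 s0 : R, 0 < s0 & forall s, 0 <= s <= s0 ->
  forall q i, i \in l q -> (Ex (fun w => (Y i w)%:R * Num.min 1 (s * (Y i w)%:R))%R <= j%:E)%E.
Hypothesis p_ge0 : forall y, [/\ 0 <= p1 y, 0 <= p2 y & 0 <= p3 y].
Hypothesis m1_gt0 : 0 < m1.
Hypothesis m2_gt0 : 0 < m2.
Hypothesis m3_ge0 : 0 <= m3.
Hypothesis b_ge0 : 0 <= b.

(* A pair [q = (v, u)] stands for the value of (X_{n-1}, X_n); [drift q] is the conditional
   mean of X_{n+1} + b X_n, immigration excluded. *)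
Definition ntot (q : nat * nat) : R := (q.1 + q.2).+1%:R.
Definition drift (q : nat * nat) : R := (m1 + b) * q.2%:R + m2 * q.1%:R.
Definition tails (q : nat * nat) (y : R) : R := p1 y * q.2%:R + p2 y * q.1%:R + p3 y.
Definition psum (y : R) : R := p1 y + p2 y + p3 y.

Let hEl q : all (mem (l q)) (l q). Proof. by apply/allP. Qed.

Lemma ntot_gt0 q : 0 < ntot q.
Proof. by rewrite ltr0n. Qed.

Let ntotE q : ntot q = q.1%:R + q.2%:R + 1.
Proof. by rewrite /ntot -natrD natr1. Qed.

Lemma tails_ge0 q y : 0 <= tails q y.
Proof. by have [? ? ?] := p_ge0 y; rewrite !addr_ge0 // mulr_ge0. Qed.

Lemma tails_le q y : tails q y <= ntot q * psum y.
Proof.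
have [? ? ?] := p_ge0 y; rewrite ntotE /tails /psum.
have := ler0n R q.1; have := ler0n R q.2; nra.
Qed.

Let mbar_ge0 : 0 <= mbar.
Proof.
have := size_l (0%N, 0%N); case E0 : (l _) => [//|i s] _.
have := @m_le (0%N, 0%N) i; rewrite E0 mem_head => /(_ isT)/andP[]; exact: le_trans.
Qed.

Let sum_const q (c : R) : \sum_(i <- l q) c = c * ntot q.
Proof. by rewrite big_const_seq count_predT iter_addr_0 size_l mulr_natr. Qed.

Let sum_m_le q : \sum_(i <- l q) m i <= mbar * ntot q.
Proof. by rewrite -sum_const big_seq [leRHS]big_seq; apply: ler_sum => i /m_le/andP[]. Qed.

Let Cw := m1^-1 + m2^-1 + 1.
Let Cw_gt0 : 0 < Cw.
Proof. by rewrite /Cw !addr_gt0 // invr_gt0. Qed.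

(** As both offspring means are positive, a drift of at most x bounds the number of summands by a
    multiple of x. Errors proportional to this number can then be absorbed into a multiple of del
    x. *)
Let ntot_le_drift q x : 1 <= x -> drift q <= x -> ntot q <= Cw * x.
Proof.
move=> x1; rewrite ntotE /drift /Cw !mulrDl mul1r => h.
have u0 := ler0n R q.2; have v0 := ler0n R q.1.
have bu : 0 <= b * q.2%:R by rewrite mulr_ge0.
have m1u : 0 <= m1 * q.2%:R by rewrite mulr_ge0 // ltW.
have m2v : 0 <= m2 * q.1%:R by rewrite mulr_ge0 // ltW.
have : q.2%:R <= m1^-1 * x by rewrite ler_pdivlMl //; lra.
have : q.1%:R <= m2^-1 * x by rewrite ler_pdivlMl //; lra.
lra.
Qed.

Let drift_le q : drift q <= (m1 + b + m2) * ntot q.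
Proof.
have u0 := ler0n R q.2; have v0 := ler0n R q.1.
have bu : 0 <= b * q.1%:R by rewrite mulr_ge0.
have m1u : 0 <= m1 * q.1%:R by rewrite mulr_ge0 // ltW.
have m2v : 0 <= m2 * q.2%:R by rewrite mulr_ge0 // ltW.
have m10 := m1_gt0; have m20 := m2_gt0; have b0 := b_ge0.
by rewrite ntotE /drift; lra.
Qed.

Let expRN_inv (t e1 : R) : 0 < e1 -> e1^-1 <= t -> expR (- t) <= e1.
Proof.
move=> e0 h; have t0 : 0 < t by apply: lt_le_trans h; rewrite invr_gt0.
rewrite expRN -[leRHS]invrK lef_pV2 ?posrE ?invr_gt0 ?expR_gt0 //.
by apply: le_trans (expR_ge1Dx _); lra.
Qed.

Let event q x : set T := [set w | x < (\sum_(i <- l q) Y i w)%:R + b * q.2%:R].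

Let mevent q x : measurable (event q x).
Proof. exact: (measurable_drv (fun k : nat => x < k%:R + b * q.2%:R) (drv_sum mY (l q) xpredT)). Qed.

Section Upper.
Variables (del kap e1 : R) (K : nat).
Hypotheses (del01 : 0 < del < 1) (K_gt0 : (0 < K)%N) (kap01 : 0 < kap <= 1) (e1_gt0 : 0 < e1).
(** Summands are cut at theta x. An excess of del x then has Bennett exponent del / theta, which
    this choice makes equal to K. *)
Let theta := del / K%:R.

Let del_gt0 : 0 < del. Proof. by case/andP: del01. Qed.
Let theta_gt0 : 0 < theta. Proof. by rewrite divr_gt0 ?ltr0n. Qed.

(* The terms correspond to: one large summand; a large drift; one moderately large summand
   together with a moderately large rest; no large summand, with few or many summands. *)
Definition upper_cond (x : R) (q : nat * nat) : R :=
  tails q ((1 - del) * x) + ((1 - del) * x < drift q)%R%:R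
  + tails q (theta * x) * Num.min 1 ((mbar + b) / (del * x) * ntot q)
  + expR (mbar / theta) * ((ntot q / x) ^+ K * (ntot q <= kap * x)%R%:R)
  + e1 * (kap * x < ntot q)%R%:R.

(* Bennett's bound, with [s = ln (x / N) / (theta x)]. *)
Lemma small_tot_exp q x : 0 < x -> drift q <= (1 - del) * x -> ntot q <= kap * x ->
  pr (E q `&` [set w | all (fun i => (Y i w)%:R <= theta * x) (l q) /\
      x - b * q.2%:R <= (\sum_(i <- l q) Y i w)%:R])
  <= pr (E q) * (expR (mbar / theta) * (ntot q / x) ^+ K).
Proof.
move=> x0 hw hN.
have m10 := m1_gt0; have m20 := m2_gt0; have b0 := b_ge0; have m30 := m3_ge0.
have e10 := e1_gt0; have [del0 del1] := andP del01.
have N0 := ntot_gt0 q.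
have tx0 : 0 < theta * x by rewrite mulr_gt0.
have Nx : ntot q <= x.
  by apply: le_trans hN _; rewrite ler_piMl ?(ltW x0) //; case/andP: kap01.
have xN0 : 0 < x / ntot q by rewrite divr_gt0.
pose s := ln (x / ntot q) / (theta * x).
have s0 : 0 <= s by rewrite divr_ge0 ?(ltW tx0) // ln_ge0 // ler_pdivlMr // mul1r.
have es : expR (s * (theta * x)) = x / ntot q by rewrite /s divfK ?gt_eqF // lnK // posrE.
have := @chernoff_sum _ _ _ P _ Y mY _ _ _ (ul q) (hEl q) (hE q) (fun k => k%:R <= theta * x)
  s (x - b * q.2%:R) (fun i => m i * (expR (s * (theta * x)) / (theta * x))).
have ha : forall i, i \in l q ->
  (Ex (fun w => ((Y i w)%:R <= theta * x)%R%:R * expR (s * (Y i w)%:R))%R <=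
   (expR (m i * (expR (s * (theta * x)) / (theta * x))))%:E)%E.
  by move=> i il; exact: (mgf_chord_le s (mY i) (Em il) tx0).
move=> /(_ ha) h; apply: le_trans (le_trans _ h) _.
  apply: pr_le => [||w [Ew [h1 h2]]].
  - apply: measurableI; first exact: (hE q).1.
    exact: (measurable_drv (fun c : bool * nat => c.1 /\ x - b * q.2%:R <= c.2%:R)
      (drv_pair (drv_all mY (l q) (fun k => k%:R <= theta * x)) (drv_sum mY (l q) xpredT))).
  - apply: measurableI; first exact: (hE q).1.
    exact: (measurable_drv (fun c : bool * nat => c.1 /\ s * (x - b * q.2%:R) <= s * c.2%:R)
      (drv_pair (drv_all mY (l q) (fun k => k%:R <= theta * x)) (drv_sum mY (l q) xpredT))).
  - by split=> //; split=> //; rewrite ler_wpM2l.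
rewrite ler_wpM2l ?pr_ge0 //.
have -> : (ntot q / x) ^+ K = expR (- (ln (x / ntot q) * K%:R)).
  by rewrite expRN expRM_natr lnK ?posrE // -exprVn invf_div.
(* Since exp(s theta x) = x / N, the N summands contribute at most mbar N (x / N) / (theta x) = mbar
   x / (theta x) to the exponent, hence the constant mbar / theta. *)
rewrite -expRD ler_expR; apply: lerB.
  rewrite -mulr_suml es; apply: le_trans (ler_wpM2r _ (sum_m_le q)) _.
    by rewrite divr_ge0 // ltW.
  by rewrite le_eqVlt; apply/orP; left; apply/eqP; field; rewrite !gt_eqF.
apply: le_trans (_ : s * (del * x) <= _).
  rewrite le_eqVlt; apply/orP; left; apply/eqP; rewrite /s /theta; field.
  by rewrite !gt_eqF // ltr0n.
rewrite ler_wpM2l //; move: hw; rewrite /drift.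
have u0 := ler0n R q.2; have v0 := ler0n R q.1.
have m1u : 0 <= m1 * q.2%:R by rewrite mulr_ge0 // ltW.
have m2v : 0 <= m2 * q.1%:R by rewrite mulr_ge0 // ltW.
lra.
Qed.

(* An exponential weak law of large numbers, with [s = lam / x]. *)
Lemma large_tot_exp : \forall x \near +oo, forall q, drift q <= (1 - del) * x ->
  pr (E q `&` [set w | all (fun i => (Y i w)%:R <= theta * x) (l q) /\
      x - b * q.2%:R <= (\sum_(i <- l q) Y i w)%:R])
  <= pr (E q) * e1.
Proof.
have m10 := m1_gt0; have m20 := m2_gt0; have b0 := b_ge0; have m30 := m3_ge0.
have e10 := e1_gt0; have [del0 del1] := andP del01.
(* The drift leaves a margin del x, of which m3 and the error from [j] use a quarter each. The
   exponent is then at most - lam del / 2 = - 1 / e1, and exp(- 1 / e1) <= e1. *)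
pose lam := 2 / (del * e1).
have lam0 : 0 < lam by rewrite divr_gt0 // mulr_gt0.
pose j := del / (4 * Cw * expR (lam * theta)).
have j0 : 0 < j by rewrite divr_gt0 // !mulr_gt0 // expR_gt0.
have [s0 s00 hs0] := unif j0.
near=> x => q hw.
have x1 : 1 <= x by near: x; exact: near_pinfty_ge.
have xm : 4 * m3 / del <= x by near: x; exact: near_pinfty_ge.
have xs : lam / s0 <= x by near: x; exact: near_pinfty_ge.
have x0 : 0 < x by lra.
pose s := lam / x.
have s_ge0 : 0 <= s by rewrite divr_ge0 // ltW.
have ss0 : s <= s0 by rewrite /s ler_pdivrMr // mulrC -ler_pdivrMr.
have sx : s * (theta * x) = lam * theta by rewrite /s; field; rewrite gt_eqF.
have Nx : ntot q <= Cw * x.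
  apply: ntot_le_drift => //; apply: le_trans hw _.
  by rewrite ler_piMl ?(ltW x0) //; lra.
have := @chernoff_sum _ _ _ P _ Y mY _ _ _ (ul q) (hEl q) (hE q) (fun k => k%:R <= theta * x)
  s (x - b * q.2%:R) (fun i => s * (m i + expR (s * (theta * x)) * j)).
have ha : forall i, i \in l q ->
  (Ex (fun w => ((Y i w)%:R <= theta * x)%R%:R * expR (s * (Y i w)%:R))%R <=
   (expR (s * (m i + expR (s * (theta * x)) * j)))%:E)%E.
  move=> i il; apply: (mgf_trunc_le (mY i) (Em il) s_ge0).
  by apply: (hs0 _ _ _ _ il); rewrite s_ge0.
move=> /(_ ha) h; apply: le_trans (le_trans _ h) _.
  apply: pr_le => [||w [Ew [h1 h2]]].
  - apply: measurableI; first exact: (hE q).1.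
    exact: (measurable_drv (fun c : bool * nat => c.1 /\ x - b * q.2%:R <= c.2%:R)
      (drv_pair (drv_all mY (l q) (fun k => k%:R <= theta * x)) (drv_sum mY (l q) xpredT))).
  - apply: measurableI; first exact: (hE q).1.
    exact: (measurable_drv (fun c : bool * nat => c.1 /\ s * (x - b * q.2%:R) <= s * c.2%:R)
      (drv_pair (drv_all mY (l q) (fun k => k%:R <= theta * x)) (drv_sum mY (l q) xpredT))).
  - by split=> //; split=> //; rewrite ler_wpM2l.
rewrite ler_wpM2l ?pr_ge0 // -mulr_sumr big_split /= sum_m sum_const sx -mulrBr.
apply: le_trans (_ : expR (- (e1^-1)) <= _); last exact: expRN_inv.
rewrite ler_expR.
have ej : expR (lam * theta) * j = del / (4 * Cw).
  by rewrite /j; field; rewrite !gt_eqF // expR_gt0.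
rewrite ej.
have h1 : del / (4 * Cw) * ntot q <= del / 4 * x.
  rewrite mulrAC ler_pdivrMr ?mulr_gt0 //.
  have := ler_wpM2l (ltW del_gt0) Nx; lra.
have h2 : m3 <= del / 4 * x by move: xm; rewrite ler_pdivrMr //; lra.
apply: le_trans (_ : s * (- (del / 2 * x)) <= _).
  by rewrite ler_wpM2l //; move: hw; rewrite /drift; lra.
rewrite le_eqVlt; apply/orP; left; apply/eqP; rewrite /s /lam; field.
by rewrite !gt_eqF.
Unshelve. all: by end_near. Qed.

Lemma cond_upper : \forall x \near +oo, forall q,
  pr (E q `&` event q x) <= pr (E q) * upper_cond x q.
Proof.
have m10 := m1_gt0; have m20 := m2_gt0; have b0 := b_ge0; have m30 := m3_ge0.
have e10 := e1_gt0; have [del0 del1] := andP del01.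
near=> x => q.
have x0 : 0 < x by near: x; exact: nbhs_pinfty_gt.
have hlarge : forall q, drift q <= (1 - del) * x ->
  pr (E q `&` [set w | all (fun i => (Y i w)%:R <= theta * x) (l q) /\
      x - b * q.2%:R <= (\sum_(i <- l q) Y i w)%:R])
  <= pr (E q) * e1 by near: x; exact: large_tot_exp.
have N0 := ntot_gt0 q.
have mEq := (hE q).1.
have min0 : 0 <= Num.min 1 ((mbar + b) / (del * x) * ntot q).
  by rewrite le_min ler01 mulr_ge0 ?(ltW N0) // divr_ge0 ?addr_ge0 // ltW // mulr_gt0.
have u1 := tails_ge0 q ((1 - del) * x).
have u2 : 0 <= tails q (theta * x) * Num.min 1 ((mbar + b) / (del * x) * ntot q).
  by rewrite mulr_ge0 ?tails_ge0.
have u3 : 0 <= expR (mbar / theta) * (ntot q / x) ^+ K.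
  by rewrite mulr_ge0 ?expR_ge0 // exprn_ge0 // divr_ge0 // ltW.
have u3' : 0 <= expR (mbar / theta) * ((ntot q / x) ^+ K * (ntot q <= kap * x)%R%:R).
  by rewrite mulrA mulr_ge0.
have u4 : 0 <= e1 * (kap * x < ntot q)%R%:R by rewrite mulr_ge0 // ltW.
(* When the drift is large, its indicator alone makes the bound trivial. *)
rewrite /upper_cond; case: (ltrP ((1 - del) * x) (drift q)) => hw.
  apply: le_trans (pr_le P (measurableI _ _ mEq (mevent q x)) mEq (@subIsetl _ _ _)) _.
  by rewrite -[leLHS]mulr1 ler_wpM2l ?pr_ge0 //; rewrite (_ : true%:R = 1 :> R) //; lra.
rewrite addr0.
pose A1 := E q `&` [set w | exists2 i, i \in l q & (1 - del) * x < (Y i w)%:R].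
pose A2 := E q `&` [set w | exists2 i, i \in l q & theta * x < (Y i w)%:R /\
        del * x <= (\sum_(j <- l q | j != i) Y j w)%:R + b * q.2%:R].
pose A3 := E q `&` [set w | all (fun i => (Y i w)%:R <= theta * x) (l q) /\
      x - b * q.2%:R <= (\sum_(i <- l q) Y i w)%:R].
have mA1 : measurable A1.
  apply: measurableI => //; apply: measurable_exists2 => i.
  exact: (measurable_drv (fun k : nat => (1 - del) * x < k%:R)).
have mA2 : measurable A2.
  apply: measurableI => //; apply: measurable_exists2 => i.
  exact: (measurable_drv (fun c : nat * nat => theta * x < c.1%:R /\ del * x <= c.2%:R + b * q.2%:R)
    (drv_pair (mY i) (drv_sum mY (l q) (fun j => j != i)))).
have mA3 : measurable A3.
  apply: measurableI => //.
  exact: (measurable_drv (fun c : bool * nat => c.1 /\ x - b * q.2%:R <= c.2%:R)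
      (drv_pair (drv_all mY (l q) (fun k => k%:R <= theta * x)) (drv_sum mY (l q) xpredT))).
have incl : E q `&` event q x `<=` A1 `|` A2 `|` A3.
  move=> w [Ew]; rewrite /event /= => hx.
  case: (pselect (exists2 i, i \in l q & (1 - del) * x < (Y i w)%:R)) => [h|n1].
    by left; left.
  case: (pselect (exists2 i, i \in l q & theta * x < (Y i w)%:R)) => [[i il hi]|n2].
    (* A summand of at most (1 - del) x leaves at least del x to the other summands and to b X_n. *)
    left; right; split=> //; exists i => //; split=> //.
    have : (Y i w)%:R <= (1 - del) * x by rewrite leNgt; apply/negP => ?; apply: n1; exists i.
    by move: hx; rewrite (bigD1_seq i) //= natrD; lra.
  right; split=> //; split; last by lra.
  by apply/allP => i il; rewrite leNgt; apply/negP => ?; apply: n2; exists i.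
apply: le_trans (pr_le P (measurableI _ _ mEq (mevent q x)) _ incl) _.
  by do 2?apply: measurableU.
apply: le_trans (prU_le P (measurableU _ _ mA1 mA2) mA3) _.
apply: le_trans (lerD (prU_le P mA1 mA2) (lexx _)) _.
rewrite -addrA -[X in _ <= _ * X]addrA -[X in _ <= _ * X]addrA mulrDr [X in _ <= _ + X]mulrDr.
apply: lerD; last apply: lerD.
- rewrite /A1; apply: le_trans (pr_jump_le mY (hEl q) (hE q) _) _.
  by rewrite sum_tail.
- have dx0 : 0 < del * x by rewrite mulr_gt0.
  have bu0 : 0 <= b * q.2%:R by rewrite mulr_ge0.
  apply: le_trans (pr_two_jumps_le mY (hEl q) (hE q) (theta * x) bu0 dx0 (@Em q)) _.
  rewrite -mulr_suml sum_tail ler_wpM2l ?pr_ge0 // ler_wpM2l ?tails_ge0 //.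
  rewrite le_min ge_min lexx /= ge_min; apply/orP; right.
  rewrite -mulrAC ler_pM2r ?invr_gt0 // mulrDl lerD // ler_wpM2l //.
  by rewrite ler_nat leqW // leq_addl.
- rewrite -/A3; case: (lerP (ntot q) (kap * x)) => hN.
    by rewrite mulr0 mulr1 addr0; exact: small_tot_exp.
  by rewrite mulr0 mulr0 add0r mulr1; exact: hlarge.
Unshelve. all: by end_near. Qed.

End Upper.

Section Lower.
Variables (del e1 : R).
Hypotheses (del01 : 0 < del < 1) (e1_gt0 : 0 < e1).
Let del_gt0 : 0 < del. Proof. by case/andP: del01. Qed.

(** The three losses: the weak law fails although the drift is large; several summands are large; a
    large summand coincides with a large drift. *)
Definition lower_err (x : R) (q : nat * nat) : R :=
  e1 * ((1 + del) * x < drift q)%R%:R + psum x * (ntot q * Num.min 1 (psum x * ntot q))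
  + psum x * (ntot q * Num.min 1 ((m1 + b + m2) / x * ntot q)).

Lemma cond_lower : \forall x \near +oo, forall q,
  pr (E q) * (tails q x + ((1 + del) * x < drift q)%R%:R)
    <= pr (E q `&` event q x) + pr (E q) * lower_err x q.
Proof.
have m10 := m1_gt0; have m20 := m2_gt0; have b0 := b_ge0; have m30 := m3_ge0.
have e10 := e1_gt0; have [del0 del1] := andP del01.
(* Here the margin left at the end is a quarter of del times the drift, so that lam del / 4 = 1 /
   e1. *)
pose lam := 4 / (del * e1).
have lam0 : 0 < lam by rewrite divr_gt0 // mulr_gt0.
pose j := del / (4 * Cw).
have j0 : 0 < j by rewrite divr_gt0 // !mulr_gt0.
have [s0 s00 hs0] := unif j0.
near=> x => q.
have x1 : 1 <= x by near: x; exact: near_pinfty_ge.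
have xs : lam / s0 <= x by near: x; exact: near_pinfty_ge.
have x0 : 0 < x by lra.
have N0 := ntot_gt0 q.
have mEq := (hE q).1.
have [p10 p20 p30] := p_ge0 x.
have pp0 : 0 <= psum x by rewrite !addr_ge0.
have cx0 : 0 <= (m1 + b + m2) / x by rewrite divr_ge0 // ?(ltW x0) // !addr_ge0 // ltW.
have t_le := tails_le q x; rewrite mulrC in t_le.
have t_ge0 := tails_ge0 q x.
rewrite /lower_err; case: (ltrP ((1 + del) * x) (drift q)) => hw; last first.
  rewrite addr0 mulr0 add0r.
  have : pr (E q) * (tails q x - tails q x * Num.min 1 (tails q x)) <= pr (E q `&` event q x).
    apply: le_trans (pr_jump_ge mY (ul q) (hEl q) (hE q) (esym (sum_tail q x))) _.
    apply: pr_le.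
    - apply: measurableI => //; apply: measurable_exists2 => i.
      exact: (measurable_drv (fun k : nat => x < k%:R)).
    - exact: measurableI.
    - move=> w [Ew [i il hi]]; split=> //; rewrite /event /=.
      apply: lt_le_trans hi _; rewrite (bigD1_seq i) //= natrD -addrA lerDl.
      by rewrite addr_ge0 // mulr_ge0.
  have : tails q x * Num.min 1 (tails q x) <= psum x * (ntot q * Num.min 1 (psum x * ntot q)).
    rewrite mulrA; apply: ler_pM => //; first by rewrite le_min ler01.
    by rewrite le_min !ge_min lexx t_le orbT.
  move=> /(ler_wpM2l (pr_ge0 P (E q))) h1 h2.
  have h3 : 0 <= pr (E q) * (psum x * (ntot q * Num.min 1 ((m1 + b + m2) / x * ntot q))).
    by rewrite !mulr_ge0 ?pr_ge0 ?(ltW N0) // le_min ler01 mulr_ge0 // ltW.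
  lra.
(* A drift above x forces N >= x / (m1 + b + m2). The minimum is then 1, and the last error term
   pays for all of [tails q x]. *)
have min1 : Num.min 1 ((m1 + b + m2) / x * ntot q) = 1.
  rewrite min_l // mulrAC ler_pdivlMr // mul1r.
  apply: le_trans (_ : drift q <= _); last exact: drift_le.
  by apply: le_trans (ltW hw); rewrite ler_peMl ?(ltW x0) //; lra.
rewrite min1 !mulr1.
have xw : x <= drift q by apply: le_trans (ltW hw); rewrite ler_peMl ?(ltW x0) //; lra.
have w0 : 0 < drift q by lra.
have w1 : 1 <= drift q by lra.
(* The scale is the drift and not x, because the drift may exceed x by any factor and the bound has
   to be uniform in q. *)
pose s := lam / drift q.
have s_ge0 : 0 <= s by rewrite divr_ge0 // ltW.
have ss0 : s <= s0.
  by rewrite /s ler_pdivrMr // mulrC -ler_pdivrMr //; apply: le_trans xs xw.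
have Nw : ntot q <= Cw * drift q by exact: ntot_le_drift.
have := @chernoff_sum _ _ _ P _ Y mY _ _ _ (ul q) (hEl q) (hE q) xpredT
  (- s) (x - b * q.2%:R) (fun i => - s * (m i - j)).
have ha : forall i, i \in l q ->
  (Ex (fun w => true%:R * expR (- s * (Y i w)%:R))%R <= (expR (- s * (m i - j)))%:E)%E.
  move=> i il; rewrite (eq_Ex P (g := fun w => expR (- s * (Y i w)%:R))); last first.
    by move=> w; rewrite mul1r.
  apply: (mgf_neg_le (mY i) (Em il) s_ge0).
  by apply: (hs0 _ _ _ _ il); rewrite s_ge0.
move=> /(_ ha) h.
have {}h : pr (E q `&` ~` event q x) <= pr (E q) * e1.
  apply: le_trans (le_trans _ h) _.
    apply: pr_le => [||w [Ew]].
    - by apply: measurableI => //; apply: measurableC.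
    - apply: measurableI => //.
      exact: (measurable_drv (fun c : bool * nat => c.1 /\ - s * (x - b * q.2%:R) <= - s * c.2%:R)
      (drv_pair (drv_all mY (l q) xpredT) (drv_sum mY (l q) xpredT))).
    - rewrite /event /= => /negP; rewrite -leNgt => hx; split=> //; split; first by apply/allP.
      by rewrite !mulNr lerN2 ler_wpM2l //; lra.
  rewrite ler_wpM2l ?pr_ge0 // -mulr_sumr big_split /= sum_m sum_const -mulrBr.
  apply: le_trans (_ : expR (- (e1^-1)) <= _); last exact: expRN_inv.
  rewrite ler_expR.
  have h1 : j * ntot q <= del / 4 * drift q.
    rewrite /j mulrAC ler_pdivrMr ?mulr_gt0 //.
    have := ler_wpM2l (ltW del_gt0) Nw; lra.
  have h2 : x <= drift q - del / 2 * drift q.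
    have : (1 - del / 2) * ((1 + del) * x) <= (1 - del / 2) * drift q.
      by rewrite ler_wpM2l ?(ltW hw) //; lra.
    have : x * (del * del) <= x * del by rewrite ler_wpM2l ?(ltW x0) // ler_piMr //; lra.
    lra.
  apply: le_trans (_ : s * (- (del / 4 * drift q)) <= _).
    rewrite mulNr -mulrN ler_wpM2l //; move: h1 h2; rewrite /drift; lra.
  rewrite le_eqVlt; apply/orP; left; apply/eqP; rewrite /s /lam; field.
  by rewrite !gt_eqF.
have := prD_setI P mEq (mevent q x); move=> hh; rewrite hh in h.
have := ler_wpM2l (pr_ge0 P (E q)) t_le.
have h3 : 0 <= pr (E q) * (psum x * (ntot q * Num.min 1 (psum x * ntot q))).
  by rewrite !mulr_ge0 ?pr_ge0 ?(ltW N0) // le_min ler01 mulr_ge0 // ltW.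
rewrite (_ : true%:R = 1 :> R) //. lra.
Unshelve. all: by end_near. Qed.

End Lower.
End Conditional.

(** * Averaging over the numbers of summands *)

Section Fibers.
Context {d : measure_display} {T : measurableType d} {R : realType}.
Variable P : probability T R.
Local Notation pr := (pr P).
Local Notation Ex := (Ex P).

(** Measurability when the index is itself random, as for a sum with a random number of terms: a
    countable union over the values of Z. *)
Lemma drv_bind (C C' : countType) (Z : T -> C) (F : C -> T -> C') :
  drv Z -> (forall q, drv (F q)) -> drv (fun w => F (Z w) w).
Proof.
move=> mZ mF c.
have -> : (fun w => F (Z w) w) @^-1` [set c] = \bigcup_n (if pickle_inv n is Some q then
    Z @^-1` [set q] `&` F q @^-1` [set c] else set0).
  apply/seteqP; split=> w /=.
    by move=> Fw; exists (pickle (Z w)) => //=; rewrite pickleK_inv.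
  by move=> [n _]; case: pickle_inv => // q [/= ->].
apply: bigcup_measurable => n _; case: pickle_inv => [q|//].
by apply: measurableI; [exact: mZ|exact: mF].
Qed.

Variables (C : countType) (Z : T -> C).
Hypothesis mZ : drv Z.

Lemma pr_le_fibers (A : set T) (h : C -> R) : measurable A -> (forall q, 0 <= h q) ->
  (forall q, pr (Z @^-1` [set q] `&` A) <= pr (Z @^-1` [set q]) * h q) ->
  ((pr A)%:E <= Ex (fun w => h (Z w)))%E.
Proof.
move=> mA h0 hle; rewrite -Ex_indic //; apply: (le_Ex_fibers mZ) => [||q].
- exact: nnmf_indic.
- exact: nnmf_drv.
- by rewrite Ex_fiber_indic // Ex_fiber // lee_fin mulrC.
Qed.

(** The error [k] is added to the probability rather than subtracted from the lower bound, so that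
    all integrands remain nonnegative. *)
Lemma pr_ge_fibers (A : set T) (h k : C -> R) : measurable A ->
  (forall q, 0 <= h q) -> (forall q, 0 <= k q) ->
  (forall q, pr (Z @^-1` [set q]) * h q <=
     pr (Z @^-1` [set q] `&` A) + pr (Z @^-1` [set q]) * k q) ->
  (Ex (fun w => h (Z w)) <= (pr A)%:E + Ex (fun w => k (Z w)))%E.
Proof.
move=> mA h0 k0 hle.
have nA : nnmf (\1_A : T -> R) by exact: nnmf_indic.
have nk : nnmf (fun w => k (Z w)) by exact: nnmf_drv.
rewrite -Ex_indic // -ExD //; apply: (le_Ex_fibers mZ) => [||q].
- exact: nnmf_drv.
- exact: nnmfD.
have nq : nnmf (\1_(Z @^-1` [set q]) : T -> R) by exact: nnmf_indic.
rewrite [leRHS](eq_Ex P (g := fun w => \1_(Z @^-1` [set q]) w * \1_A w +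
  \1_(Z @^-1` [set q]) w * k (Z w))); last by move=> w; rewrite mulrDr.
rewrite ExD; [|exact: nnmfM|exact: nnmfM].
by rewrite Ex_fiber_indic // !Ex_fiber // -EFinD lee_fin ![_ * pr _]mulrC.
Qed.

Lemma Ex_drv_indic (p : C -> bool) : Ex (fun w => (p (Z w))%:R) = (pr [set w | p (Z w)])%:E.
Proof.
rewrite -Ex_indic; last exact: (measurable_drv (fun q => p q)).
apply: eq_Ex => w; rewrite indicE; congr (_%:R); congr nat_of_bool.
by apply/idP/idP => [h|/set_mem]; [rewrite mem_set|].
Qed.

End Fibers.

(** * Truncated power moments *)

Section TruncatedMoment.
Context {d : measure_display} {T : measurableType d} {R : realType}.
Variable P : probability T R.
Local Notation pr := (pr P).
Local Notation Ex := (Ex P).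
Variables (C : countType) (Z : T -> C) (h : C -> R).
Hypothesis mZ : drv Z.
Hypothesis h_ge0 : forall q, 0 <= h q.
Variables (g : R -> R) (alpha : R).
Hypothesis g_gt0 : forall x, 0 < g x.
Hypothesis g_noninc : forall x y, x <= y -> g y <= g x.
Hypothesis g_rv : forall q, 0 < q -> negl g (fun x => g (q * x) - q `^ (- alpha) * g x).
Hypothesis tail_h : asymO g (fun x => pr [set w | x < h (Z w)]).

Definition trmom (K : nat) (x : R) : R :=
  fine (Ex (fun w => (h (Z w) / x) ^+ K * (h (Z w) <= x)%R%:R)).

Let nmom (K : nat) (x : R) : 0 < x -> nnmf (fun w => (h (Z w) / x) ^+ K * (h (Z w) <= x)%R%:R).
Proof.
move=> x0; apply: (nnmf_drv (h := fun q => (h q / x) ^+ K * (h q <= x)%R%:R)) => // q.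
by rewrite mulr_ge0 // exprn_ge0 // divr_ge0 // ltW.
Qed.

Let mom_le1 (K : nat) (x : R) : 0 < x ->
  (Ex (fun w => (h (Z w) / x) ^+ K * (h (Z w) <= x)%R%:R)%R <= 1%:E)%E.
Proof.
move=> x0; rewrite -[leRHS](Ex_cst P); apply: le_Ex; [exact: nmom|exact: nnmf_cst|move=> w].
case: (lerP (h (Z w)) x) => hx; last by rewrite mulr0.
by rewrite mulr1 exprn_ile1 ?divr_ge0 ?(ltW x0) // ler_pdivrMr // mul1r.
Qed.

Lemma trmomE (K : nat) (x : R) : 0 < x ->
  Ex (fun w => (h (Z w) / x) ^+ K * (h (Z w) <= x)%R%:R) = (trmom K x)%:E.
Proof.
move=> x0; rewrite fineK // ge0_fin_numE; last by apply: Ex_ge0; exact: nmom.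
exact: le_lt_trans (mom_le1 _ x0) (ltry _).
Qed.

(** Where h <= x, the ratio of h to the scale is halved; where x < h <= 2 x, the integrand is at
    most 1 and the tail at x accounts for it. *)
Lemma trmom_double (K : nat) (x : R) : 0 < x ->
  trmom K (2 * x) <= 2 ^- K * trmom K x + pr [set w | x < h (Z w)].
Proof.
move=> x0; have x20 : 0 < 2 * x by rewrite mulr_gt0.
have c0 : (0 : R) <= 2 ^- K by rewrite invr_ge0 exprn_ge0.
rewrite -lee_fin EFinD EFinM -!trmomE // -(Ex_drv_indic P mZ (fun q => x < h q)).
have n1 := nmom K x0.
have n2 : nnmf (fun w => (x < h (Z w))%R%:R : R).
  exact: (nnmf_drv (h := fun q => (x < h q)%R%:R)).
rewrite -ExZ // -ExD //; last exact: nnmfZ.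
apply: le_Ex; [exact: nmom|by apply: nnmfD => //; exact: nnmfZ|move=> w].
have hw := h_ge0 (Z w).
case: (lerP (h (Z w)) x) => hx.
  rewrite addr0 mulr1 -exprVn -exprMn.
  have -> : 2^-1 * (h (Z w) / x) = h (Z w) / (2 * x) by field; rewrite gt_eqF.
  rewrite ler_piMr ?exprn_ge0 ?divr_ge0 ?(ltW x20) //.
  by rewrite lern1 leq_b1.
rewrite mulr0 mulr0 add0r; case: (lerP (h (Z w)) (2 * x)) => h2; last by rewrite mulr0.
by rewrite mulr1 exprn_ile1 ?divr_ge0 ?(ltW x20) // ler_pdivrMr // mul1r.
Qed.

(* A Karamata-type bound: doubling [x] divides the truncated moment by [2 ^ K], while [g]
   only loses a factor about [2 ^ alpha]. *)
Lemma trmom_asymO (K : nat) : alpha + 2 <= K%:R -> asymO g (trmom K).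
Proof.
move=> hK; have g0 x : 0 <= g x := ltW (g_gt0 x).
have [C0 C00 hC0] := asymO_pos g0 tail_h.
(* Half of the limiting ratio, so that g(2 x) >= c g(x) eventually, while K >= alpha + 2 still gives
   2^(-K) <= c / 2. *)
pose c : R := 2 `^ (- alpha) / 2.
have c0 : 0 < c by rewrite divr_gt0 // powR_gt0.
have c2 : 0 < 2 `^ (- alpha) :> R by rewrite powR_gt0.
have cc : c < 2 `^ (- alpha) by rewrite /c; lra.
have hc : 2 ^- K <= c / 2.
  rewrite -powR_mulrn // -powRN (_ : c / 2 = 2 `^ (- alpha - 2)).
    by rewrite ler_powR ?ler1n //; lra.
  rewrite powRB ?pnatr_eq0 ?implybT // /c -mulrA -invfM; congr (_ / _).
  by rewrite -[2]/(2%:R) powR_mulrn // expr2.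
have [M [_ hM]] : \forall x \near +oo, `|pr [set w | x < h (Z w)]| <= C0 * g x /\ c * g x <= g (2 * x).
  near=> x; split; first by near: x.
  by near: x; apply: (g_scale_ge (alpha := alpha)).
pose x0 := Num.max M 0 + 1.
have x00 : 0 < x0 by rewrite ltr_wpDl // le_max lexx orbT.
have x0M : M < x0 by rewrite ltr_pwDr // le_max lexx.
(* The first entry covers the base interval, where the truncated moment is at most 1. The second
   lets the tail term C0 g(x) fit into the half of B c g(x) that the doubled moment leaves free. *)
pose B := Num.max (1 / g (2 * x0)) (2 * C0 / c).
have hB : forall x, x0 <= x -> trmom K x / g x <= B.
  apply: doubling_bound => // x.
    move=> /andP[h1 h2]; have xp : 0 < x by lra.
    rewrite le_max; apply/orP; left; apply: ler_pM => //.
    - by rewrite -lee_fin -trmomE //; apply: Ex_ge0; exact: nmom.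
    - by rewrite invr_ge0.
    - by rewrite -lee_fin -trmomE // mom_le1.
    - by rewrite lef_pV2 ?posrE // g_noninc.
  move=> hx; have xp : 0 < x by lra.
  have [|t1 t2] := hM x; first by lra.
  rewrite !ler_pdivrMr // => t3.
  have B0 : 0 <= B by rewrite le_max divr_ge0.
  apply: le_trans (_ : B * (c * g x) <= _); last by rewrite ler_wpM2l.
  apply: le_trans (trmom_double _ xp) _.
  have t4 : 2 ^- K * trmom K x <= c / 2 * (B * g x).
    apply: ler_pM => //.
    by rewrite -lee_fin -trmomE //; apply: Ex_ge0; exact: nmom.
  have t5 : 2 * C0 * g x <= B * c * g x.
    by rewrite ler_wpM2r // -ler_pdivrMr // le_max lexx orbT.
  have := le_trans (ler_norm _) t1; lra.
exists B; near=> x.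
have hx : x0 <= x by near: x; exact: near_pinfty_ge.
have xp : 0 < x by lra.
rewrite ger0_norm; last by rewrite -lee_fin -trmomE //; apply: Ex_ge0; exact: nmom.
by rewrite -ler_pdivrMr // hB.
Unshelve. all: by end_near. Qed.

End TruncatedMoment.

(** * Tail recursion over one generation *)

Section Step.
Context {d : measure_display} {T : measurableType d} {R : realType}.
Variables (P : probability T R) (I : eqType) (Y : I -> T -> nat).
Hypothesis mY : forall i, drv (Y i).
Local Notation pr := (pr P).
Local Notation Ex := (Ex P).
Variables (Z : T -> nat * nat) (l : nat * nat -> seq I) (m : I -> R).
Variables (m1 m2 m3 mbar b : R) (p1 p2 p3 : R -> R).
Hypothesis mZ : drv Z.
Hypothesis ul : forall q, uniq (l q).
Hypothesis hE : forall q, indep_of P Y (Z @^-1` [set q]) (mem (l q)).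
Hypothesis size_l : forall q, size (l q) = (q.1 + q.2).+1.
Hypothesis Em : forall q i, i \in l q -> Ex (fun w => (Y i w)%:R) = (m i)%:E.
Hypothesis m_le : forall q i, i \in l q -> 0 <= m i <= mbar.
Hypothesis sum_m : forall q, \sum_(i <- l q) m i = m1 * q.2%:R + m2 * q.1%:R + m3.
Hypothesis sum_tail : forall q y, \sum_(i <- l q) tailP P (Y i) y
  = p1 y * q.2%:R + p2 y * q.1%:R + p3 y.
Hypothesis unif : forall j, 0 < j -> exists2 s0 : R, 0 < s0 & forall s, 0 <= s <= s0 ->
  forall q i, i \in l q -> (Ex (fun w => (Y i w)%:R * Num.min 1 (s * (Y i w)%:R))%R <= j%:E)%E.
Hypothesis m1_gt0 : 0 < m1.
Hypothesis m2_gt0 : 0 < m2.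
Hypothesis m3_ge0 : 0 <= m3.
Hypothesis b_ge0 : 0 <= b.

Variables (EU EV : R).
Hypothesis EUE : Ex (fun w => (Z w).2%:R) = EU%:E.
Hypothesis EVE : Ex (fun w => (Z w).1%:R) = EV%:E.

Local Notation stepsum w := (\sum_(i <- l (Z w)) Y i w)%N.

Lemma drv_stepsum : drv (fun w => stepsum w).
Proof. by apply: (drv_bind mZ (F := fun q w => (\sum_(i <- l q) Y i w)%N)) => q; exact: drv_sum. Qed.

Let nUV (h : nat * nat -> R) : (forall q, 0 <= h q) -> nnmf (fun w => h (Z w)).
Proof. by move=> h0; apply: nnmf_drv. Qed.

(** Wald's identity, fibre by fibre: the summands listed for q are independent of the event Z =
    q. *)
Lemma Ex_stepsum : Ex (fun w => (stepsum w)%:R) = (m1 * EU + m2 * EV + m3)%:E.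
Proof.
have m1_ge0 := ltW m1_gt0; have m2_ge0 := ltW m2_gt0.
have nid i : nnmf (fun w => (Y i w)%:R : R) by exact: (nnmf_drv (h := fun k => k%:R)).
have nU : nnmf (fun w => (Z w).2%:R : R) by apply: (nUV (h := fun q => q.2%:R)).
have nV : nnmf (fun w => (Z w).1%:R : R) by apply: (nUV (h := fun q => q.1%:R)).
have nS : nnmf (fun w => (stepsum w)%:R : R).
  by apply: (nnmf_drv (h := fun k : nat => k%:R)) => //; exact: drv_stepsum.
pose h q : R := m1 * q.2%:R + m2 * q.1%:R + m3.
have h0 q : 0 <= h q by rewrite !addr_ge0 // mulr_ge0.
have nh := nUV h0.
transitivity (Ex (fun w => h (Z w))); last first.
  rewrite /h ExD; [|by apply: nnmfD; exact: nnmfZ|exact: nnmf_cst].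
  rewrite ExD; [|exact: nnmfZ|exact: nnmfZ].
  by rewrite !ExZ // Ex_cst EUE EVE -!EFinM -!EFinD.
have fib q : Ex (fun w => \1_(Z @^-1` [set q]) w * (stepsum w)%:R) =
             Ex (fun w => \1_(Z @^-1` [set q]) w * h (Z w)).
  rewrite Ex_fiber // mulrC.
  rewrite (eq_Ex P (g := fun w => \sum_(i <- l q) \1_(Z @^-1` [set q]) w * (Y i w)%:R)); last first.
    move=> w; rewrite -mulr_sumr -natr_sum indicE.
    by case: (boolP (w \in _)) => [/set_mem /= ->//|]; rewrite !mul0r.
  have nq : nnmf (\1_(Z @^-1` [set q]) : T -> R) by exact: nnmf_indic.
  rewrite Ex_sum; last by move=> i; exact: nnmfM.
  rewrite (@eq_big_seq _ _ _ _ _ _ (fun j => (pr (Z @^-1` [set q]) * m j)%:E)); last first.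
    move=> j jl.
    have := @Ex_prod _ _ _ P _ Y mY _ _ [:: j] (fun _ k => k%:R) m _ isT _ (hE q).
    rewrite !big_seq1 => <- //.
    - by apply: eq_Ex => w; rewrite big_seq1.
    - by rewrite /= jl.
    - by move=> k; rewrite inE => /eqP ->; exact: Em jl.
  by rewrite sumEFin -mulr_sumr sum_m.
by apply/eqP; rewrite eq_le; apply/andP; split; apply: (le_Ex_fibers mZ) => // q; rewrite fib.
Qed.

Variables (g : R -> R) (alpha : R).
Hypothesis alpha_ge0 : 0 <= alpha.
Hypothesis g_gt0 : forall x, 0 < g x.
Hypothesis g_noninc : forall x y, x <= y -> g y <= g x.
Hypothesis g_rv : forall q, 0 < q -> negl g (fun x => g (q * x) - q `^ (- alpha) * g x).
Hypothesis p1_rv : rvO g alpha p1.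
Hypothesis p2_rv : rvO g alpha p2.
Hypothesis p3_rv : rvO g alpha p3.
Hypothesis p1_noninc : forall x y, x <= y -> p1 y <= p1 x.
Hypothesis p2_noninc : forall x y, x <= y -> p2 y <= p2 x.
Hypothesis p3_noninc : forall x y, x <= y -> p3 y <= p3 x.
Hypothesis p_small : forall e, 0 < e -> \forall x \near +oo, p1 x + p2 x + p3 x <= e.
Hypothesis tail_tot : asymO g (fun x => pr [set w | x < @ntot R (Z w)]).
Hypothesis tail_wt : rvO g alpha (fun x => pr [set w | x < drift m1 m2 b (Z w)]).

(** This is the case a = 1 of the recursion; any a > 0 is reduced to it by dividing by a. *)
Definition step_main (x : R) : R :=
  p1 x * EU + p2 x * EV + p3 x + pr [set w | x < drift m1 m2 b (Z w)].

Let g_ge0 x : 0 <= g x := ltW (g_gt0 x).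

Let p_ge0 y : [/\ 0 <= p1 y, 0 <= p2 y & 0 <= p3 y].
Proof. by split; [case: p1_rv|case: p2_rv|case: p3_rv]. Qed.

Let EU0 : 0 <= EU.
Proof. by rewrite -lee_fin -EUE; apply/Ex_ge0/(nUV (h := fun q => q.2%:R)). Qed.

Let EV0 : 0 <= EV.
Proof. by rewrite -lee_fin -EVE; apply/Ex_ge0/(nUV (h := fun q => q.1%:R)). Qed.

Lemma rvO_step_main : rvO g alpha step_main.
Proof.
by apply: rvOD => //; apply: rvOD => //; apply: rvOD => //; apply: rvOZr.
Qed.

Let pp_asymO : asymO g (psum p1 p2 p3).
Proof. by apply: asymOD; [apply: asymOD|]; [case: p1_rv|case: p2_rv|case: p3_rv]. Qed.

Let tails0 q y : 0 <= tails p1 p2 p3 q y.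
Proof. exact: tails_ge0. Qed.

Let ntot0 q : 0 <= @ntot R q.
Proof. exact/ltW/ntot_gt0. Qed.

Let Ex_tails y : Ex (fun w => tails p1 p2 p3 (Z w) y) = (p1 y * EU + p2 y * EV + p3 y)%:E.
Proof.
have [h1 h2 h3] := p_ge0 y.
have nU : nnmf (fun w => (Z w).2%:R : R) by apply: (nUV (h := fun q => q.2%:R)).
have nV : nnmf (fun w => (Z w).1%:R : R) by apply: (nUV (h := fun q => q.1%:R)).
rewrite /tails ExD; [|by apply: nnmfD; exact: nnmfZ|exact: nnmf_cst].
rewrite ExD; [|exact: nnmfZ|exact: nnmfZ].
by rewrite !ExZ // Ex_cst EUE EVE -!EFinM -!EFinD.
Qed.

Let Ex_tot : Ex (fun w => @ntot R (Z w)) = (EV + EU + 1)%:E.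
Proof.
have nU : nnmf (fun w => (Z w).2%:R : R) by apply: (nUV (h := fun q => q.2%:R)).
have nV : nnmf (fun w => (Z w).1%:R : R) by apply: (nUV (h := fun q => q.1%:R)).
rewrite (eq_Ex P (g := fun w => (Z w).1%:R + (Z w).2%:R + 1)); last first.
  by move=> w; rewrite /ntot -natrD natr1.
rewrite ExD; [|exact: nnmfD|exact: nnmf_cst].
by rewrite ExD // Ex_cst EUE EVE -!EFinD.
Qed.

Let small_tot (e : R) : 0 < e -> exists2 s0 : R, 0 < s0 & forall s, 0 <= s <= s0 ->
    (Ex (fun w => @ntot R (Z w) * Num.min 1 (s * @ntot R (Z w)))%R <= e%:E)%E.
Proof. by apply: (trunc_small mZ ntot0); rewrite Ex_tot ltry. Qed.

Let nmin c : 0 <= c -> nnmf (fun w => @ntot R (Z w) * Num.min 1 (c * @ntot R (Z w))).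
Proof.
move=> c0; apply: (nUV (h := fun q => @ntot R q * Num.min 1 (c * @ntot R q))) => q.
by rewrite mulr_ge0 // le_min ler01 mulr_ge0.
Qed.

Let nbool (p : nat * nat -> bool) : nnmf (fun w => (p (Z w))%:R : R).
Proof. exact: (nUV (h := fun q => (p q)%:R)). Qed.

Let A x : set T := [set w | x < (stepsum w)%:R + b * (Z w).2%:R].

Let mA x : measurable (A x).
Proof.
exact: (measurable_drv (fun c : nat * (nat * nat) => x < c.1%:R + b * c.2.2%:R)
  (drv_pair drv_stepsum mZ)).
Qed.

Let A_fiber q x : Z @^-1` [set q] `&` A x =
  Z @^-1` [set q] `&` [set w | x < (\sum_(i <- l q) Y i w)%:R + b * q.2%:R].
Proof. by apply/seteqP; split=> w [/= Zw]; rewrite /A /= Zw. Qed.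

Let mbar_ge0 : 0 <= mbar.
Proof.
have := size_l (0%N, 0%N); case E0 : (l _) => [//|i s] _.
have := @m_le (0%N, 0%N) i; rewrite E0 mem_head => /(_ isT)/andP[]; exact: le_trans.
Qed.

Lemma step_upper (del e : R) : 0 < del < 1 -> 0 < e ->
  \forall x \near +oo, pr (A x) <= step_main ((1 - del) * x) + e * g x.
Proof.
move=> del01 e0; have [del0 del1] := andP del01.
have e4 : 0 < e / 3 by lra.
have [K [K0 hK]] : exists K, (0 < K)%N /\ alpha + 2 <= K%:R.
  exists (Num.truncn alpha).+3; split=> //.
  by have := ltW (truncnS_gt alpha); rewrite -[(_).+3%:R]natr1 -[(_).+2%:R]natr1; lra.
pose theta := del / K%:R.
have theta0 : 0 < theta by rewrite divr_gt0 ?ltr0n.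
pose C2 := expR (mbar / theta).
have C20 : 0 < C2 by exact: expR_gt0.
have [CH CH0 hCH] := asymO_pos g_ge0 (trmom_asymO mZ ntot0 g_gt0 g_noninc g_rv tail_tot hK).
have [CN CN0 hCN] := asymO_pos g_ge0 tail_tot.
have [CP CP0 hCP] := asymO_pos g_ge0 (asymO_scale g_gt0 g_rv theta0 pp_asymO).
(* The few-summands term is at most C2 CH kap^K g(kap x) / g(x) times g(x), that is, at most 2 C2 CH
   kap g(x), since K - alpha >= 1 and g(kap x) <= 2 kap^(-alpha) g(x). *)
pose kap := Num.min 1 (e / 3 / (2 * C2 * CH)).
have kap0 : 0 < kap by rewrite lt_min ltr01 /= divr_gt0 // !mulr_gt0.
have kap1 : kap <= 1 by rewrite ge_min lexx.
have kap01 : 0 < kap <= 1 by rewrite kap0.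
have kapa : 0 < kap `^ (- alpha) by rewrite powR_gt0.
(* Chosen after [kap]: the event of many summands has probability up to 2 CN kap^(-alpha) g(x), and
   [e1] has to compensate for it. *)
pose e1 := e / 3 / (2 * CN * kap `^ (- alpha)).
have e10 : 0 < e1 by rewrite divr_gt0 // !mulr_gt0.
have eP : 0 < e / 3 / CP by rewrite divr_gt0.
have [s0 s00 hs0] := small_tot eP.
have hup := cond_upper mY ul hE size_l Em m_le sum_m sum_tail unif p_ge0 m1_gt0 m2_gt0
  m3_ge0 b_ge0 del01 K0 kap01 e10.
have hkap : kap ^+ K * (2 * kap `^ (- alpha)) <= 2 * kap.
  rewrite -powR_mulrn ?(ltW kap0) // mulrCA ler_pM2l // -powRD; last first.
    by rewrite (gt_eqF kap0) implybT.
  rewrite -[leRHS]powRr1 ?(ltW kap0) //; apply: ger_powR => //.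
  by have := alpha_ge0; lra.
near=> x.
have x0 : 0 < x by near: x; exact: nbhs_pinfty_gt.
have hux : forall q, pr (Z @^-1` [set q] `&` [set w | x < (\sum_(i <- l q) Y i w)%:R + b * q.2%:R])
  <= pr (Z @^-1` [set q]) * upper_cond m1 m2 mbar b p1 p2 p3 del kap e1 K x q by near: x.
have xs : (mbar + b) / del / s0 <= x by near: x; exact: near_pinfty_ge.
have gk : g (kap * x) <= 2 * kap `^ (- alpha) * g x.
  by near: x; apply: (g_scale_le (alpha := alpha)) => //; rewrite ltr_pMl // ltr1n.
have hH : `|trmom P Z (@ntot R) K (kap * x)| <= CH * g (kap * x).
  by near: x; exact: (near_pinftyZ kap0 hCH).
have hN : `|pr [set w | kap * x < @ntot R (Z w)]| <= CN * g (kap * x).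
  by near: x; exact: (near_pinftyZ kap0 hCN).
have hP : `|psum p1 p2 p3 (theta * x)| <= CP * g x by near: x.
have dx0 : 0 < del * x by rewrite mulr_gt0.
have kx0 : 0 < kap * x by rewrite mulr_gt0.
set c := (mbar + b) / (del * x).
have mb0 : 0 <= mbar + b by rewrite addr_ge0.
have c0 : 0 <= c by rewrite divr_ge0 // ltW.
have cs : c <= s0.
  by rewrite /c invfM mulrA ler_pdivrMr // [s0 * _]mulrC -ler_pdivrMr //.
have pp0 y : 0 <= psum p1 p2 p3 y by have [? ? ?] := p_ge0 y; rewrite !addr_ge0.
have h1 : ((pr (A x))%:E <= Ex (fun w => (((tails p1 p2 p3 (Z w) ((1 - del) * x)
   + ((1 - del) * x < drift m1 m2 b (Z w))%R%:R)
   + psum p1 p2 p3 (theta * x) * (@ntot R (Z w) * Num.min 1 (c * @ntot R (Z w))))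
   + C2 * kap ^+ K * ((@ntot R (Z w) / (kap * x)) ^+ K * (@ntot R (Z w) <= kap * x)%R%:R))
   + e1 * (kap * x < @ntot R (Z w))%R%:R)%R)%E.
  have min0 q : 0 <= Num.min 1 (c * @ntot R q) by rewrite le_min ler01 mulr_ge0.
  apply: (pr_le_fibers mZ (h := fun q => (((tails p1 p2 p3 q ((1 - del) * x)
   + ((1 - del) * x < drift m1 m2 b q)%R%:R)
   + psum p1 p2 p3 (theta * x) * (@ntot R q * Num.min 1 (c * @ntot R q)))
   + C2 * kap ^+ K * ((@ntot R q / (kap * x)) ^+ K * (@ntot R q <= kap * x)%R%:R))
   + e1 * (kap * x < @ntot R q)%R%:R)) => // q.
    apply: addr_ge0; last by rewrite mulr_ge0 // ltW.
    apply: addr_ge0; last first.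
      rewrite mulr_ge0 ?mulr_ge0 ?exprn_ge0 ?(ltW C20) ?(ltW kap0) //.
      by rewrite divr_ge0 // ltW.
    by apply: addr_ge0; [exact: addr_ge0|do 2 apply: mulr_ge0 => //].
  rewrite A_fiber; apply: le_trans (hux q) _; rewrite ler_wpM2l ?pr_ge0 // /upper_cond.
  rewrite -/theta -/C2 -/c lerD2r; apply: lerD; first rewrite lerD2l.
    by rewrite mulrA ler_wpM2r // [leRHS]mulrC; apply: tails_le.
  (* Taking the truncated moment at scale kap x instead of x releases the factor kap^K. *)
  rewrite -mulrA ler_pM2l // mulrA -exprMn.
  have -> : kap * (@ntot R q / (kap * x)) = @ntot R q / x by field; rewrite !gt_eqF.
  by [].
have n1 := nUV (fun q => tails0 q ((1 - del) * x)).
have n2 := nbool (fun q => (1 - del) * x < drift m1 m2 b q).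
have n3 := nmin c0.
have n4 : nnmf (fun w => (@ntot R (Z w) / (kap * x)) ^+ K * (@ntot R (Z w) <= kap * x)%R%:R).
  apply: (nUV (h := fun q => (@ntot R q / (kap * x)) ^+ K * (@ntot R q <= kap * x)%R%:R)) => q.
  by rewrite mulr_ge0 // exprn_ge0 // divr_ge0 // ltW.
have n5 := nbool (fun q => kap * x < @ntot R q).
have Ck0 : 0 <= C2 * kap ^+ K by rewrite mulr_ge0 ?exprn_ge0 // ltW.
move: h1.
rewrite ExD; [|do !apply: nnmfD => //; exact: nnmfZ|by apply: nnmfZ => //; exact: ltW].
rewrite ExD; [|do !apply: nnmfD => //; exact: nnmfZ|exact: nnmfZ].
rewrite ExD; [|exact: nnmfD|exact: nnmfZ].
rewrite ExD // Ex_tails !ExZ ?(ltW e10) //.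
rewrite (Ex_drv_indic P mZ (fun q => (1 - del) * x < drift m1 m2 b q)).
rewrite (Ex_drv_indic P mZ (fun q => kap * x < @ntot R q)).
rewrite (trmomE P mZ ntot0) //.
have hc : (Ex (fun w => @ntot R (Z w) * Num.min 1 (c * @ntot R (Z w)))%R <= (e / 3 / CP)%:E)%E.
  by apply: hs0; rewrite c0.
move=> h1.
have {h1} : ((pr (A x))%:E <= (p1 ((1 - del) * x) * EU + p2 ((1 - del) * x) * EV + p3 ((1 - del) * x)
   + pr [set w | ((1 - del) * x < drift m1 m2 b (Z w))%R]
   + psum p1 p2 p3 (theta * x) * (e / 3 / CP) + C2 * kap ^+ K * trmom P Z (@ntot R) K (kap * x)
   + e1 * pr [set w | (kap * x < @ntot R (Z w))%R])%:E)%E.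
  apply: le_trans h1 _.
  rewrite [leRHS]EFinD; apply: leeD; last by rewrite [leRHS]EFinM.
  rewrite [leRHS]EFinD; apply: leeD; last by rewrite [leRHS]EFinM.
  rewrite [leRHS]EFinD; apply: leeD; first by rewrite [leRHS]EFinD.
  by rewrite [leRHS]EFinM lee_wpmul2l // lee_fin.
rewrite lee_fin => h1; apply: le_trans h1 _; rewrite /step_main -!addrA; do 4 apply: lerD => //.
have t1 : psum p1 p2 p3 (theta * x) * (e / 3 / CP) <= e / 3 * g x.
  apply: le_trans (ler_wpM2r (ltW eP) (le_trans (ler_norm _) hP)) _.
  by rewrite le_eqVlt; apply/orP; left; apply/eqP; field; rewrite gt_eqF.
have t2 : C2 * kap ^+ K * trmom P Z (@ntot R) K (kap * x) <= e / 3 * g x.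
  apply: le_trans (_ : C2 * kap ^+ K * (CH * (2 * kap `^ (- alpha) * g x)) <= _).
    rewrite ler_wpM2l //; apply: le_trans (le_trans (ler_norm _) hH) _.
    by rewrite ler_pM2l.
  have -> : C2 * kap ^+ K * (CH * (2 * kap `^ (- alpha) * g x)) =
    C2 * CH * (kap ^+ K * (2 * kap `^ (- alpha))) * g x by ring.
  rewrite ler_wpM2r //; apply: le_trans (_ : C2 * CH * (2 * kap) <= _).
    by rewrite ler_wpM2l // mulr_ge0 // ltW.
  have : kap <= e / 3 / (2 * C2 * CH) by rewrite ge_min lexx orbT.
  by rewrite ler_pdivlMr ?mulr_gt0 //; lra.
have t3 : e1 * pr [set w | kap * x < @ntot R (Z w)] <= e / 3 * g x.
  apply: le_trans (_ : e1 * (CN * (2 * kap `^ (- alpha) * g x)) <= _).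
    rewrite ler_wpM2l ?(ltW e10) //; apply: le_trans (le_trans (ler_norm _) hN) _.
    by rewrite ler_pM2l.
  rewrite le_eqVlt; apply/orP; left; apply/eqP; rewrite /e1; field.
  by rewrite !gt_eqF.
lra.
Unshelve. all: by end_near. Qed.

Lemma step_lower (del e : R) : 0 < del < 1 -> 0 < e ->
  \forall x \near +oo, step_main ((1 + del) * x) - e * g x <= pr (A x).
Proof.
move=> del01 e0; have [del0 del1] := andP del01.
have e4 : 0 < e / 3 by lra.
have dp0 : 0 < 1 + del by lra.
have [_ Ow _] := tail_wt.
have [CN CN0 hCN] := asymO_pos g_ge0 (asymO_scale g_gt0 g_rv dp0 Ow).
have [CP CP0 hCP] := asymO_pos g_ge0 pp_asymO.
pose e1 := e / 3 / CN.
have e10 : 0 < e1 by rewrite divr_gt0.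
have eP : 0 < e / 3 / CP by rewrite divr_gt0.
have [s0 s00 hs0] := small_tot eP.
have hlo := cond_lower mY ul hE size_l Em sum_m sum_tail unif p_ge0 m1_gt0 m2_gt0
  m3_ge0 b_ge0 del01 e10.
near=> x.
have x0 : 0 < x by near: x; exact: nbhs_pinfty_gt.
have hlx : forall q, pr (Z @^-1` [set q]) * (tails p1 p2 p3 q x + ((1 + del) * x < drift m1 m2 b q)%R%:R)
  <= pr (Z @^-1` [set q] `&` [set w | x < (\sum_(i <- l q) Y i w)%:R + b * q.2%:R])
   + pr (Z @^-1` [set q]) * lower_err m1 m2 b p1 p2 p3 del e1 x q by near: x.
have xs : (m1 + b + m2) / s0 <= x by near: x; exact: near_pinfty_ge.
have hN : `|pr [set w | (1 + del) * x < drift m1 m2 b (Z w)]| <= CN * g x by near: x.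
have hP : `|psum p1 p2 p3 x| <= CP * g x by near: x.
have ps : psum p1 p2 p3 x <= s0 by near: x; exact: p_small.
set c := (m1 + b + m2) / x in hlx *.
have mb0 : 0 <= m1 + b + m2 by rewrite !addr_ge0 // ltW.
have c0 : 0 <= c by rewrite divr_ge0 // ltW.
have cs : c <= s0 by rewrite /c ler_pdivrMr // mulrC -ler_pdivrMr //.
have pp0 y : 0 <= psum p1 p2 p3 y by have [? ? ?] := p_ge0 y; rewrite !addr_ge0.
have n1 := nUV (fun q => tails0 q x).
have n2 := nbool (fun q => (1 + del) * x < drift m1 m2 b q).
have n3 := nmin c0.
have n4 := nmin (pp0 x).
have := pr_ge_fibers mZ (mA x)
  (h := fun q => tails p1 p2 p3 q x + ((1 + del) * x < drift m1 m2 b q)%R%:R)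
  (k := lower_err m1 m2 b p1 p2 p3 del e1 x).
have hh0 q : 0 <= tails p1 p2 p3 q x + ((1 + del) * x < drift m1 m2 b q)%R%:R.
  by rewrite addr_ge0.
have hk0 q : 0 <= lower_err m1 m2 b p1 p2 p3 del e1 x q.
  have min0 a : 0 <= a -> 0 <= Num.min 1 (a * ntot q) by move=> ?; rewrite le_min ler01 mulr_ge0.
  apply: addr_ge0; last by do 2 apply: mulr_ge0 => //; exact: min0.
  by apply: addr_ge0; [apply: mulr_ge0 => //; exact: ltW|do 2 apply: mulr_ge0 => //; exact: min0].
have hf q : pr (Z @^-1` [set q]) * (tails p1 p2 p3 q x + ((1 + del) * x < drift m1 m2 b q)%R%:R)
  <= pr (Z @^-1` [set q] `&` A x) + pr (Z @^-1` [set q]) * lower_err m1 m2 b p1 p2 p3 del e1 x q.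
  by rewrite A_fiber.
move=> /(_ P hh0 hk0 hf); rewrite /lower_err -/c.
have k1 := nnmfZ (ltW e10) n2; have k2 := nnmfZ (pp0 x) n4; have k3 := nnmfZ (pp0 x) n3.
rewrite ExD // (ExD P (nnmfD k1 k2) k3) (ExD P k1 k2).
rewrite Ex_tails (ExZ P (ltW e10) n2) (ExZ P (pp0 x) n4) (ExZ P (pp0 x) n3).
rewrite (Ex_drv_indic P mZ (fun q => (1 + del) * x < drift m1 m2 b q)).
(* Each coincidence error is [psum x], which is O(g x), times a mean N min(1, s N) with s equal to
   [c] or to [psum x]; both values of s tend to 0. *)
have hc1 : (Ex (fun w => @ntot R (Z w) * Num.min 1 (c * @ntot R (Z w)))%R <= (e / 3 / CP)%:E)%E.
  by apply: hs0; rewrite c0.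
have hc2 : (Ex (fun w => @ntot R (Z w) * Num.min 1 (psum p1 p2 p3 x * @ntot R (Z w)))%R <= (e / 3 / CP)%:E)%E.
  by apply: hs0; rewrite pp0.
move=> h1.
have {h1} : ((p1 x * EU + p2 x * EV + p3 x + pr [set w | ((1 + del) * x < drift m1 m2 b (Z w))%R])%:E
   <= (pr (A x) + (e1 * pr [set w | ((1 + del) * x < drift m1 m2 b (Z w))%R]
     + psum p1 p2 p3 x * (e / 3 / CP) + psum p1 p2 p3 x * (e / 3 / CP)))%:E)%E.
  rewrite EFinD; apply: le_trans h1 _; rewrite [leRHS]EFinD; apply: leeD => //.
  rewrite [leRHS]EFinD; apply: leeD; last by rewrite [leRHS]EFinM lee_wpmul2l // lee_fin.
  rewrite [leRHS]EFinD; apply: leeD; first by rewrite [leRHS]EFinM.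
  by rewrite [leRHS]EFinM lee_wpmul2l // lee_fin.
rewrite lee_fin => h1.
have t1 : psum p1 p2 p3 x * (e / 3 / CP) <= e / 3 * g x.
  apply: le_trans (ler_wpM2r (ltW eP) (le_trans (ler_norm _) hP)) _.
  by rewrite le_eqVlt; apply/orP; left; apply/eqP; field; rewrite gt_eqF.
have t3 : e1 * pr [set w | (1 + del) * x < drift m1 m2 b (Z w)] <= e / 3 * g x.
  apply: le_trans (_ : e1 * (CN * g x) <= _).
    by rewrite ler_wpM2l ?(ltW e10) //; apply: le_trans (ler_norm _) hN.
  by rewrite mulrA /e1 divfK // gt_eqF.
(* The jump terms are available at x; monotonicity of the tails moves them to (1 + del) x, the
   argument at which the sandwich evaluates the whole main term. *)
have xd : x <= (1 + del) * x by rewrite ler_peMl ?(ltW x0) //; lra.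
have t4 := ler_wpM2r EU0 (p1_noninc xd).
have t5 := ler_wpM2r EV0 (p2_noninc xd).
have t6 := p3_noninc xd.
rewrite /step_main; lra.
Unshelve. all: by end_near. Qed.

Lemma step_asym : negl g (fun x => pr (A x) - step_main x).
Proof.
apply: (negl_sandwich g_gt0 rvO_step_main); [exact: step_upper|exact: step_lower].
Qed.

End Step.

(** * The closed form *)

Section ClosedForm.
Context {R : realType}.
Variables (mxi meta : R).
Hypothesis mxi_gt0 : 0 < mxi.
Hypothesis meta_gt0 : 0 < meta.

(* Coefficients of the conditional mean of a X_{n+1} + b X_n on X_n and X_{n-1}. *)
Definition adj_step (ab : R * R) : R * R := (ab.1 * mxi + ab.2, ab.1 * meta).

(** The two numbers are the eigenvalues of M, the roots of y^2 = mxi y + meta; they differ because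
    the discriminant is positive. *)
Lemma lam_facts : [/\ lam_plus mxi meta - lam_minus mxi meta != 0,
  lam_plus mxi meta ^+ 2 = mxi * lam_plus mxi meta + meta,
  lam_minus mxi meta ^+ 2 = mxi * lam_minus mxi meta + meta &
  lam_plus mxi meta + lam_minus mxi meta = mxi].
Proof.
have h1 := mxi_gt0; have h2 := meta_gt0.
have D0 : 0 < mxi ^+ 2 + 4 * meta by rewrite addr_gt0 ?exprn_gt0 ?mulr_gt0.
have s0 : 0 < Num.sqrt (mxi ^+ 2 + 4 * meta) by rewrite sqrtr_gt0.
have sq := sqr_sqrtr (ltW D0).
rewrite /lam_plus /lam_minus; set s := Num.sqrt _ in s0 sq *.
split.
- by rewrite (_ : _ - _ = s) ?gt_eqF //; field.
- by rewrite expr2 in sq *; field: sq.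
- by rewrite expr2 in sq *; field: sq.
- by field.
Qed.

Lemma mkE k : mk mxi meta k = (lam_plus mxi meta ^+ k.+1 - lam_minus mxi meta ^+ k.+1)
    / (lam_plus mxi meta - lam_minus mxi meta).
Proof. by rewrite /mk; case: k => //=; have [h _ _ _] := lam_facts; rewrite !expr1 divff. Qed.

Lemma mk1 : mk mxi meta 1 = mxi.
Proof.
have [h _ _ hs] := lam_facts; rewrite mkE -[RHS]hs.
by rewrite subr_sqr mulrAC divff // mul1r.
Qed.

Lemma mkSS k : mk mxi meta k.+2 = mxi * mk mxi meta k.+1 + meta * mk mxi meta k.
Proof.
have [h hp hm _] := lam_facts; rewrite !mkE mulrA mulrA -mulrDl; congr (_ / _).
have e (y : R) : y ^+ k.+3 = y ^+ 2 * y ^+ k.+1 by rewrite -exprD.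
rewrite !e hp hm !(exprS _ k.+1); ring.
Qed.

(** [adj_step] is the transpose of M acting on coefficients, and its first component obeys the
    recurrence of the m_k. The second is meta m_{k-1}, with m_{-1} = 0 at the start. *)
Lemma iter_adj_step k : iter k adj_step (1, 0) =
  (mk mxi meta k, if k is k'.+1 then meta * mk mxi meta k' else 0).
Proof.
elim: k => [|k IH] //; rewrite iterS IH /adj_step /=; congr pair; last by rewrite mulrC.
case: k {IH} => [|k]; first by rewrite mk1 mul1r addr0.
by rewrite mkSS [_ * mxi]mulrC.
Qed.

Variables (e0 em1 meps : R).

Fixpoint mean_pair (n : nat) : R * R :=
  if n is k.+1 then ((mean_pair k).2, mxi * (mean_pair k).2 + meta * (mean_pair k).1 + meps)
  else (em1, e0).

Local Notation M := (Mmat mxi meta).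

(** Variation of constants for the affine recursion of the means. The components are swapped because
    [mean_pair], like [gw_pair], lists generation n - 1 before generation n. *)
Lemma mean_pairE n : col2 (mean_pair n).2 (mean_pair n).1 =
  M ^+ n *m col2 e0 em1 + \sum_(1 <= i < n.+1) M ^+ (n - i) *m col2 meps 0.
Proof.
elim: n => [|n IH]; first by rewrite expr0 mul1mx big_nil addr0.
rewrite big_nat_recr //= subnn expr0 mul1mx.
rewrite (eq_big_nat _ _ (F2 := fun i => M *m (M ^+ (n - i) *m col2 meps 0))); last first.
  by move=> i /andP[_ hi]; rewrite subSn // exprS -mulmxE -mulmxA.
rewrite -mulmx_sumr exprS -mulmxE -mulmxA addrA -mulmxDr -IH.
apply/matrixP => i j; rewrite !mxE big_ord_recl big_ord1 !mxE /=.
by case: i => [[|[|//]] hi] /=; ring.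
Qed.

Variables (alpha : R) (p1 p2 p3 : R -> R).

(* The asymptotics of P(a X_n + b X_{n-1} > x): a large jump happens either at the last
   generation, or earlier, and then the last generation follows its conditional mean. *)
Fixpoint lin_main (n : nat) (a b x : R) : R :=
  if n is k.+1 then
    a `^ alpha * (p1 x * (mean_pair k).2 + p2 x * (mean_pair k).1 + p3 x)
    + lin_main k (a * mxi + b) (a * meta) x
  else 0.

(** The k-th term belongs to a jump k generations before the last: it arises from the mean
    population at time n - k - 1 and is then propagated k times by the conditional mean. *)
Lemma lin_mainE n a b x : lin_main n a b x =
  \sum_(0 <= k < n) (iter k adj_step (a, b)).1 `^ alpha *
    (p1 x * (mean_pair (n - k - 1)).2 + p2 x * (mean_pair (n - k - 1)).1 + p3 x).
Proof.
elim: n a b => [|n IH] a b; first by rewrite big_nil.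
rewrite /= big_nat_recl //= IH subSS subn0; congr (_ + _).
apply: eq_bigr => k _; rewrite subSS.
by have -> : iter k adj_step (a * mxi + b, a * meta) = iter k.+1 adj_step (a, b) by rewrite iterSr.
Qed.

Let dotE (v : 'cV[R]_2) x : (v^T *m col2 (p1 x) (p2 x)) 0 0 = p1 x * v 0 0 + p2 x * v 1 0.
Proof.
rewrite !mxE big_ord_recl big_ord1 !mxE /= mulrC [v _ _ * p2 x]mulrC.
by congr (_ + _ * v _ _); apply: val_inj.
Qed.

Lemma lin_main_closed n x : lin_main n 1 0 x =
  \sum_(0 <= k < n) (mk mxi meta k) `^ alpha *
     ((col2 e0 em1)^T *m (M ^+ (n - k - 1))^T *m col2 (p1 x) (p2 x)) 0 0
  + \sum_(1 <= i < n) \sum_(0 <= j < n - i) (mk mxi meta j) `^ alpha *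
     ((col2 meps 0)^T *m (M ^+ (n - i - j - 1))^T *m col2 (p1 x) (p2 x)) 0 0
  + \sum_(1 <= i < n.+1) (mk mxi meta (n - i)%N) `^ alpha * p3 x.
Proof.
rewrite lin_mainE.
have -> : \sum_(1 <= i < n.+1) mk mxi meta (n - i) `^ alpha * p3 x =
          \sum_(0 <= k < n) mk mxi meta k `^ alpha * p3 x.
  rewrite big_add1 /= big_nat_rev /= add0n; apply: eq_big_nat => i /andP[_ hi].
  by rewrite subnSK // subKn // ltnW.
pose q l := ((col2 meps 0)^T *m (M ^+ l)^T *m col2 (p1 x) (p2 x)) 0 0.
(* Exchange of summation over the triangle i >= 1, i + j < n, so that the outer index becomes the
   age of the jump; both inner ranges are first extended to n with a condition. *)
have -> : \sum_(1 <= i < n) \sum_(0 <= j < n - i) (mk mxi meta j) `^ alpha * q (n - i - j - 1)%N =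
  \sum_(0 <= k < n) \sum_(1 <= i < (n - k - 1).+1) (mk mxi meta k) `^ alpha * q (n - k - 1 - i)%N.
  rewrite (@big_nat_widenl _ _ _ 1 0) //.
  transitivity (\sum_(0 <= i < n | (0 < i)%N) \sum_(0 <= j < n | (j < n - i)%N)
     (mk mxi meta j) `^ alpha * q (n - i - j - 1)%N).
    by apply: eq_bigr => i _; rewrite [LHS](big_nat_widen _ _ n) ?leq_subr.
  rewrite (exchange_big_dep_nat xpredT) //=.
  apply: eq_big_nat => k /andP[_ hk].
  rewrite [RHS](big_nat_widen _ _ n); last by rewrite subn1 prednK ?subn_gt0 // leq_subr.
  rewrite [RHS](@big_nat_widenl _ _ _ 1 0) //.
  apply: eq_big => [i|i _]; first by rewrite /= andbC; congr (_ && _); lia.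
  by congr (_ * q _); lia.
rewrite -!big_split /=; apply: eq_bigr => k _.
rewrite iter_adj_step /= -mulr_sumr -!mulrDr; congr (_ * _); congr (_ + _).
set l := (n - k - 1)%N.
have -> : p1 x * (mean_pair l).2 + p2 x * (mean_pair l).1 =
   ((col2 (mean_pair l).2 (mean_pair l).1)^T *m col2 (p1 x) (p2 x)) 0 0.
  by rewrite dotE !mxE.
rewrite mean_pairE linearD /= mulmxDl [LHS]mxE trmx_mul; congr (_ + _).
rewrite linear_sum /= mulmx_suml summxE; apply: eq_bigr => i _.
by rewrite trmx_mul.
Qed.

End ClosedForm.

(** * The process *)

Section Laws.
Context {d : measure_display} {T : measurableType d} {R : realType}.
Variable P : probability T R.
Local Notation pr := (pr P).
Local Notation Ex := (Ex P).

Lemma same_law_Ex (X X' : T -> nat) (h : nat -> R) : drv X -> drv X' -> same_law P X X' ->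
  (forall k, 0 <= h k) -> Ex (fun w => h (X w)) = Ex (fun w => h (X' w)).
Proof.
move=> mX mX' XX h0; rewrite (Ex_nat_fibers P mX) ?(Ex_nat_fibers P mX'); try exact: nnmf_drv.
apply: eq_eseriesr => n _; rewrite !Ex_fiber //; congr (_ * fine _)%:E; exact: XX.
Qed.

Lemma same_law_tailP (X X' : T -> nat) (y : R) : drv X -> drv X' -> same_law P X X' ->
  tailP P X y = tailP P X' y.
Proof.
move=> mX mX' XX; apply: EFin_inj.
rewrite -(Ex_drv_indic P mX (fun k => y < k%:R)) -(Ex_drv_indic P mX' (fun k => y < k%:R)).
exact: (same_law_Ex (h := fun k => (y < k%:R)%R%:R)).
Qed.

Lemma tailP_noninc (X : T -> nat) (x y : R) : drv X -> x <= y -> tailP P X y <= tailP P X x.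
Proof.
move=> mX xy; apply: pr_le => [||w /=]; last exact: le_lt_trans.
- exact: (measurable_drv (fun k : nat => y < k%:R)).
- exact: (measurable_drv (fun k : nat => x < k%:R)).
Qed.

Lemma tailP_small (X : T -> nat) (m e : R) : drv X -> meanE P X = m%:E -> 0 < e ->
  \forall x \near +oo, tailP P X x <= e.
Proof.
move=> mX EX e0; near=> x.
have x1 : 1 <= x by near: x; exact: near_pinfty_ge.
have xm : m / e <= x by near: x; exact: near_pinfty_ge.
have x0 : 0 < x by lra.
have mA : measurable [set w | x < (X w)%:R] by exact: (measurable_drv (fun k : nat => x < k%:R)).
have nX : nnmf (fun w => (X w)%:R : R) by exact: (nnmf_drv (h := fun k => k%:R)).
have := markov_le P mA nX x0 (fun w h => ltW h).
rewrite [X in (_ <= X)%E]EX lee_fin => h.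
rewrite -(ler_pM2l x0); apply: le_trans h _; move: xm; rewrite ler_pdivrMr //.
Unshelve. all: by end_near. Qed.

Lemma mean_finite (X : T -> nat) (r : R) : drv X -> 1 <= r -> (momentE P X r < +oo)%E ->
  meanE P X = (fine (meanE P X))%:E.
Proof.
move=> mX r1 hr; rewrite fineK // ge0_fin_numE; last first.
  by apply: Ex_ge0; exact: (nnmf_drv (h := fun k => k%:R)).
apply: le_lt_trans hr; apply: le_Ex.
- exact: (nnmf_drv (h := fun k => k%:R)).
- by apply: (nnmf_drv (h := fun k => k%:R `^ r)) => // k; exact: powR_ge0.
move=> w; case: (X w) => [|k]; first exact: powR_ge0.
by rewrite -[leLHS]powRr1 // ler_powR // ler1n.
Qed.

Lemma moment_tail (X : T -> nat) (r c : R) : drv X -> 0 < r -> (momentE P X r < +oo)%E ->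
  0 <= c -> exists2 C : R, 0 <= C & forall x, 0 < x ->
    pr [set w | x < c * (X w)%:R] <= C * x `^ (- r).
Proof.
move=> mX r0 hr c0.
have nX : nnmf (fun w => (X w)%:R `^ r : R).
  by apply: (nnmf_drv (h := fun k => k%:R `^ r)) => // k; exact: powR_ge0.
have Er : momentE P X r = (fine (momentE P X r))%:E.
  by rewrite fineK // ge0_fin_numE //; apply: Ex_ge0.
have Er0 : 0 <= fine (momentE P X r) by apply: fine_ge0; apply: Ex_ge0.
exists (c `^ r * fine (momentE P X r)); first by rewrite mulr_ge0 // powR_ge0.
move=> x x0; rewrite powRN ler_pdivlMr ?powR_gt0 //.
have mA : measurable [set w | x < c * (X w)%:R].
  exact: (measurable_drv (fun k : nat => x < c * k%:R)).
rewrite -lee_fin mulrC [leRHS]EFinM -Er -ExZ ?powR_ge0 //.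
apply: markov_le => //; last 2 first.
- by rewrite powR_gt0.
- move=> w /= /ltW hw; rewrite -powRM // ge0_ler_powR ?nnegrE ?(ltW x0) ?(ltW r0) //.
  by rewrite mulr_ge0.
by apply: nnmfZ => //; rewrite powR_ge0.
Qed.

End Laws.

(** * Tails of regularly varying variables *)

Section RegVar.
Context {d : measure_display} {T : measurableType d} {R : realType}.
Variables (P : probability T R) (alpha : R).

(** A tail that vanishes somewhere vanishes from there on. The quotient for q = 1 would then be 0 by
    the convention on division by 0, whereas it tends to 1. *)
Lemma reg_var_gt0 (X : T -> nat) : drv X -> reg_var P X alpha -> forall x, 0 < tailP P X x.
Proof.
move=> mX rX x.
have h1 : (0 : R) < 1 by [].
have := @cvgr_gt _ _ _ _ _ _ (rX 1 h1) 0; rewrite powR1 => /(_ _ h1) [M [_ hM]].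
have := hM (Num.max M x + 1); rewrite ltr_pwDr // ?le_max ?lexx // => /(_ isT) h.
apply: lt_le_trans (tailP_noninc P mX (_ : x <= Num.max M x + 1)); last first.
  by rewrite -[leLHS]addr0 lerD // le_max lexx orbT.
rewrite lt_neqAle pr_ge0 andbT; apply/eqP => h0.
by move: h; rewrite -h0 invr0 mulr0 ltxx.
Qed.

Lemma reg_var_negl (X : T -> nat) : drv X -> reg_var P X alpha ->
  forall q, 0 < q -> negl (tailP P X) (fun x => tailP P X (q * x) - q `^ (- alpha) * tailP P X x).
Proof.
move=> mX rX q q0 e e0; have tX := reg_var_gt0 mX rX.
have /cvgrPdist_le/(_ _ e0) h := rX q q0.
near=> x; have : `|q `^ (- alpha) - tailP P X (q * x) / tailP P X x| <= e by near: x.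
rewrite -(ler_pM2r (tX x)) -[X in _ * X <= _](gtr0_norm (tX x)) -normrM distrC mulrBl.
by rewrite divfK ?gt_eqF.
Unshelve. all: by end_near. Qed.

Lemma bigO_inf_asymO (X X' : T -> nat) : drv X' -> reg_var P X' alpha ->
  bigO_inf (tailP P X) (tailP P X') -> asymO (tailP P X') (tailP P X).
Proof.
move=> mX rX [C hC]; exists C; near=> x.
rewrite ger0_norm ?pr_ge0 // -ler_pdivrMr ?(reg_var_gt0 mX rX) //; near: x => //.
Unshelve. all: by end_near. Qed.

(** The defect of regular variation of X is negligible against its own tail, hence against the
    dominating tail of X'. *)
Lemma rvO_tailP (X X' : T -> nat) : drv X -> drv X' -> reg_var P X alpha -> reg_var P X' alpha ->
  bigO_inf (tailP P X) (tailP P X') -> rvO (tailP P X') alpha (tailP P X).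
Proof.
move=> mX mX' rX rX' hO; have O := bigO_inf_asymO mX' rX' hO.
split=> // [x|q q0]; first exact: pr_ge0.
apply: negl_trans O => //; first by move=> x; exact: pr_ge0.
- by move=> x; exact: pr_ge0.
- exact: reg_var_negl.
Qed.

End RegVar.

(** * Independence of the past from later variables *)

Section Process.
Context {d : measure_display} {T : measurableType d} {R : realType}.
Variables (P : probability T R).
Variables (Xm1 X0 : T -> nat) (xi eta : nat -> nat -> T -> nat) (eps : nat -> T -> nat).
Local Notation pr := (pr P).
Local Notation Ex := (Ex P).
Local Notation Y := (gw_family Xm1 X0 xi eta eps).
Local Notation pair := (gw_pair Xm1 X0 xi eta eps).
Hypothesis mY : forall k : gw_idx, drv (Y k).
Hypothesis iY : mutually_indep P Y.

(* The indices of the variables in the sum that defines X_{n+1}; [q] stands for the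
   value of (X_{n-1}, X_n). *)
Definition offspring (n : nat) (q : nat * nat) : seq gw_idx :=
  [seq inr (inl (n, i)) | i <- iota 0 q.2] ++
  [seq inr (inr (inl (n, j))) | j <- iota 0 q.1] ++ [:: inr (inr (inr n))].

Definition future (n : nat) (k : gw_idx) : bool :=
  match k with
  | inl _ => false
  | inr (inl (i, _)) => (n <= i)%N
  | inr (inr (inl (i, _))) => (n <= i)%N
  | inr (inr (inr i)) => (n <= i)%N
  end.

Lemma uniq_offspring n q : uniq (offspring n q).
Proof.
rewrite /offspring !cat_uniq /= !map_inj_uniq ?iota_uniq; try by move=> i j [].
rewrite /= andbT orbF; apply/andP; split.
  apply/hasPn => k; rewrite mem_cat inE => /orP[/mapP[j _ ->]|/eqP ->];
  by apply/mapP => -[].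
by apply/mapP => -[].
Qed.

Lemma size_offspring n q : size (offspring n q) = (q.1 + q.2).+1.
Proof. by rewrite /offspring !size_cat !size_map !size_iota /= addn1 addnS addnC. Qed.

Lemma big_offspring (V : nmodType) (F : gw_idx -> V) n q :
  \sum_(k <- offspring n q) F k = \sum_(i < q.2) F (inr (inl (n, val i)))
    + \sum_(j < q.1) F (inr (inr (inl (n, val j)))) + F (inr (inr (inr n))).
Proof.
have e r : iota 0 r = index_iota 0 r by rewrite /index_iota subn0.
by rewrite /offspring !big_cat !big_map big_seq1 /= !e !big_mkord addrA.
Qed.

Lemma offspringP n q k : k \in offspring n q ->
  [\/ exists i, k = inr (inl (n, i)), exists j, k = inr (inr (inl (n, j)))
    | k = inr (inr (inr n))].
Proof.
rewrite /offspring !mem_cat inE => /or3P[/mapP[i _ ->]|/mapP[j _ ->]|/eqP ->].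
- by constructor 1; exists i.
- by constructor 2; exists j.
- by constructor 3.
Qed.

Lemma gw_pairS n w : pair n.+1 w = ((pair n w).2, \sum_(k <- offspring n (pair n w)) Y k w)%N.
Proof. by rewrite /= big_offspring. Qed.

(** The event that fixes (X_n, X_{n+1}) is a disjoint union over the value k of X_{n-1}: the
    previous pair is fixed, and a sum over [offspring] has a given value. That sum uses up only
    first index n, which [future n.+1] excludes. *)
Lemma indep_past n q : indep_of P Y (pair n @^-1` [set q]) (future n).
Proof.
elim: n q => [|n IH] [v u].
  have hT : indep_of P Y setT xpredT.
    split=> // s A us _; rewrite setTI prT mul1r; exact: iY.
  have := indep_of_setI mY [set u] (indep_of_setI mY [set v] hT (i := inl false) isT)
    (i := inl true) isT.
  rewrite setTI (_ : _ `&` _ = pair 0 @^-1` [set (v, u)]); last first.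
    by apply/seteqP; split=> w /= [-> ->].
  by apply: indep_of_sub => -[[]|].
rewrite (_ : _ @^-1` _ = \bigcup_k (pair n @^-1` [set (k, v)] `&`
    [set w | (0 + \sum_(i <- offspring n (k, v)) Y i w)%N = u])); last first.
  apply/seteqP; split=> w /=.
    rewrite -[X in X = _]/(pair n.+1 w) gw_pairS => -[h1 h2]; exists (pair n w).1 => //.
    by split; rewrite /= -h1 -surjective_pairing // add0n.
  move=> [k _ [h1 h2]]; rewrite -[X in X = _]/(pair n.+1 w) gw_pairS h1 /=.
  by rewrite -h2 add0n.
apply: (indep_of_bigcup mY).
  by move=> i j _ _ [w [[/= E1 _] [/= + _]]]; rewrite E1 => -[].
move=> k; apply: indep_of_sub (indep_of_sum mY 0 u (uniq_offspring n (k, v)) _ (IH (k, v))).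
  move=> j hj; apply/andP; split; last first.
    by case: j hj => [//|[[i ?]|[[i ?]|i]]] /=; exact: ltnW.
  by apply/negP => /offspringP[[i E]|[i E]|E]; move: hj; rewrite E /= ltnn.
by apply/allP => j /offspringP[[i ->]|[i ->]|->] /=; exact: leqnn.
Qed.

Lemma drv_pair_n n : drv (pair n).
Proof. by move=> q; exact: (indep_past n q).1. Qed.

End Process.

(** * Induction over the generations *)

Section LinearCombinations.
Context {d : measure_display} {T : measurableType d} {R : realType}.
Variables (P : probability T R).
Variables (Xm1 X0 : T -> nat) (xi eta : nat -> nat -> T -> nat) (eps : nat -> T -> nat).
Variables (alpha r : R).
Local Notation pr := (pr P).
Local Notation Ex := (Ex P).
Local Notation Y := (gw_family Xm1 X0 xi eta eps).
Local Notation pair := (gw_pair Xm1 X0 xi eta eps).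
Hypothesis mY : forall k : gw_idx, drv (Y k).
Hypothesis iY : mutually_indep P Y.
Hypothesis law_xi : forall n i, same_law P (xi n i) (xi 0%N 0%N).
Hypothesis law_eta : forall n j, same_law P (eta n j) (eta 0%N 0%N).
Hypothesis law_eps : forall n, same_law P (eps n) (eps 0%N).
Hypothesis alpha_ge1 : 1 <= alpha.
Hypothesis rv_xi : reg_var P (xi 0%N 0%N) alpha.
Hypothesis rv_eta : reg_var P (eta 0%N 0%N) alpha.
Hypothesis rv_eps : reg_var P (eps 0%N) alpha.
Hypothesis O_xi : bigO_inf (tailP P (xi 0%N 0%N)) (tailP P (eps 0%N)).
Hypothesis O_eta : bigO_inf (tailP P (eta 0%N 0%N)) (tailP P (eps 0%N)).
Hypothesis E_xi : (0 < meanE P (xi 0%N 0%N) < +oo)%E.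
Hypothesis E_eta : (0 < meanE P (eta 0%N 0%N) < +oo)%E.
Hypothesis E_eps : (0 < meanE P (eps 0%N) < +oo)%E.
Hypothesis alpha_r : alpha < r.
Hypothesis mom_X0 : (momentE P X0 r < +oo)%E.
Hypothesis mom_Xm1 : (momentE P Xm1 r < +oo)%E.

Local Notation mxi := (fine (meanE P (xi 0%N 0%N))).
Local Notation meta := (fine (meanE P (eta 0%N 0%N))).
Local Notation meps := (fine (meanE P (eps 0%N))).
Local Notation p1 := (tailP P (xi 0%N 0%N)).
Local Notation p2 := (tailP P (eta 0%N 0%N)).
Local Notation g := (tailP P (eps 0%N)).
Local Notation mean n := (mean_pair mxi meta (fine (meanE P X0)) (fine (meanE P Xm1)) meps n).
Local Notation main := (lin_main mxi meta (fine (meanE P X0)) (fine (meanE P Xm1)) meps alpha p1 p2 g).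

Let mxi_rv n i : drv (xi n i). Proof. exact: (mY (inr (inl (n, i)))). Qed.
Let meta_rv n j : drv (eta n j). Proof. exact: (mY (inr (inr (inl (n, j))))). Qed.
Let meps_rv n : drv (eps n). Proof. exact: (mY (inr (inr (inr n)))). Qed.
Let mX0_rv : drv X0. Proof. exact: (mY (inl true)). Qed.
Let mXm1_rv : drv Xm1. Proof. exact: (mY (inl false)). Qed.

Let finE (x : \bar R) : (0 < x < +oo)%E -> x = (fine x)%:E /\ 0 < fine x.
Proof. by case: x => [x||] //=; rewrite ?andbF // lte_fin => /andP[]. Qed.

Let g_gt0 x : 0 < g x. Proof. exact: (reg_var_gt0 (meps_rv 0) rv_eps). Qed.
Let g_noninc x y : x <= y -> g y <= g x. Proof. exact: tailP_noninc. Qed.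
Let g_rv q : 0 < q -> negl g (fun x => g (q * x) - q `^ (- alpha) * g x).
Proof. exact: (reg_var_negl (meps_rv 0) rv_eps). Qed.
Let p1_rv : rvO g alpha p1. Proof. exact: rvO_tailP. Qed.
Let p2_rv : rvO g alpha p2. Proof. exact: rvO_tailP. Qed.
Let g_rvO : rvO g alpha g. Proof. exact: rvO_self. Qed.

(** The value at an initial variable is a dummy, as no [offspring] list contains one. *)
Let mean_of (k : gw_idx) : R :=
  match k with
  | inl _ => 0 | inr (inl _) => mxi | inr (inr (inl _)) => meta | inr (inr (inr _)) => meps
  end.

Let Ex_offspring (h : nat -> R) n q k : (forall i, 0 <= h i) -> k \in offspring n q ->
  Ex (fun w => h (Y k w)) = Ex (fun w => h (
    match k with inl _ => 0%N | inr (inl _) => xi 0%N 0%N w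
      | inr (inr (inl _)) => eta 0%N 0%N w | inr (inr (inr _)) => eps 0%N w end)).
Proof.
move=> h0 /offspringP[[i ->]|[j ->]|->] /=.
- by apply: same_law_Ex => //; exact: law_xi.
- by apply: same_law_Ex => //; exact: law_eta.
- by apply: same_law_Ex => //; exact: law_eps.
Qed.

Let Em n q k : k \in offspring n q -> Ex (fun w => (Y k w)%:R) = (mean_of k)%:E.
Proof.
move=> hk; rewrite (Ex_offspring (h := fun i => i%:R) _ hk) //.
case/offspringP: hk => [[i ->]|[j ->]|->] /=; [have := finE E_xi|have := finE E_eta|have := finE E_eps];
by case=> <-.
Qed.

Let m_le n q k : k \in offspring n q -> 0 <= mean_of k <= mxi + meta + meps.
Proof.
have [_ h1] := finE E_xi; have [_ h2] := finE E_eta; have [_ h3] := finE E_eps.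
by case/offspringP => [[i ->]|[j ->]|->] /=; apply/andP; split; lra.
Qed.

Let sum_m n q : \sum_(k <- offspring n q) mean_of k = mxi * q.2%:R + meta * q.1%:R + meps.
Proof. by rewrite big_offspring /= !sumr_const !card_ord !mulr_natr. Qed.

Let sum_tail n q y :
  \sum_(k <- offspring n q) tailP P (Y k) y = p1 y * q.2%:R + p2 y * q.1%:R + g y.
Proof.
rewrite big_offspring /=.
rewrite (eq_bigr (fun=> p1 y)); last by move=> i _; exact: same_law_tailP.
rewrite [X in _ + X + _](eq_bigr (fun=> p2 y)); last by move=> i _; exact: same_law_tailP.
by rewrite !sumr_const !card_ord !mulr_natr (same_law_tailP _ _ _ (law_eps n)).
Qed.

Let unif n j : 0 < j -> exists2 s0 : R, 0 < s0 & forall s, 0 <= s <= s0 ->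
  forall q k, k \in offspring n q ->
  (Ex (fun w => (Y k w)%:R * Num.min 1 (s * (Y k w)%:R))%R <= j%:E)%E.
Proof.
move=> j0.
have [|s1 s10 h1] := @trunc_small _ _ _ P _ (xi 0%N 0%N) (fun k => k%:R) j (mxi_rv 0 0) (ler0n R) _ j0.
  by case/andP: E_xi.
have [|s2 s20 h2] := @trunc_small _ _ _ P _ (eta 0%N 0%N) (fun k => k%:R) j (meta_rv 0 0) (ler0n R) _ j0.
  by case/andP: E_eta.
have [|s3 s30 h3] := @trunc_small _ _ _ P _ (eps 0%N) (fun k => k%:R) j (meps_rv 0) (ler0n R) _ j0.
  by case/andP: E_eps.
exists (Num.min s1 (Num.min s2 s3)); first by rewrite !lt_min s10 s20.
move=> s; rewrite !le_min => /and4P[s0 le1 le2 le3] q k hk.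
rewrite (Ex_offspring (h := fun i => i%:R * Num.min 1 (s * i%:R)) _ hk); last first.
  by move=> i; rewrite mulr_ge0 // le_min ler01 mulr_ge0.
case/offspringP: hk => [[i ->]|[i ->]|->] /=.
- by apply: h1; rewrite s0.
- by apply: h2; rewrite s0.
- by apply: h3; rewrite s0.
Qed.

Let hE n q : indep_of P Y (pair n @^-1` [set q]) (mem (offspring n q)).
Proof.
apply: indep_of_sub (indep_past mY iY n q) => k /offspringP[[i ->]|[j ->]|->] /=; exact: leqnn.
Qed.

Lemma Ex_pair n : Ex (fun w => (pair n w).2%:R) = (mean n).2%:E /\
  Ex (fun w => (pair n w).1%:R) = (mean n).1%:E.
Proof.
have r1 : 1 <= r by have := alpha_ge1; have := alpha_r; lra.
have [_ h1] := finE E_xi; have [_ h2] := finE E_eta; have [_ h3] := finE E_eps.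
elim: n => [|n [IH2 IH1]].
  by split; [rewrite -(mean_finite mX0_rv r1)|rewrite -(mean_finite mXm1_rv r1)].
split; last exact: IH2.
rewrite -[RHS](Ex_stepsum mY (drv_pair_n mY iY n) (hE n) (@Em n) (sum_m n) h1 h2 (ltW h3) IH2 IH1).
by apply: eq_Ex => w; rewrite gw_pairS.
Qed.

Let mean_ge0 n : 0 <= (mean n).2 /\ 0 <= (mean n).1.
Proof.
have [h2 h1] := Ex_pair n; have mZ := drv_pair_n mY iY n.
rewrite -!lee_fin -h1 -h2; split; apply: Ex_ge0.
- exact: (nnmf_drv (h := fun q : nat * nat => q.2%:R)).
- exact: (nnmf_drv (h := fun q : nat * nat => q.1%:R)).
Qed.

Lemma rvO_lin_main n a b : rvO g alpha (main n a b).
Proof.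
have g_ge0 x : 0 <= g x := ltW (g_gt0 x).
elim: n a b => [|n IH] a b /=; first exact: rvO0.
have [h2 h1] := mean_ge0 n.
apply: rvOD => //; apply: rvOZ; first exact: powR_ge0.
by apply: rvOD => //; apply: rvOD => //; apply: rvOZr.
Qed.

Let lin_tail n (a b x : R) := pr [set w | x < a * (pair n w).2%:R + b * (pair n w).1%:R].

(** The induction is on n for all coefficients together, since one step replaces (a, b) by (a mxi +
    b, a meta). The hypothesis for other coefficients also supplies the tail estimates which that
    step requires. *)
Lemma lin_asym n a b : 0 <= a -> 0 <= b ->
  negl g (fun x => lin_tail n a b x - main n a b x).
Proof.
have g_ge0 x : 0 <= g x := ltW (g_gt0 x).
have a1 := alpha_ge1; have ar := alpha_r.
have alpha0 : 0 <= alpha by lra.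
have r0 : 0 < r by lra.
have [_ h1] := finE E_xi; have [_ h2] := finE E_eta; have [Eeps h3] := finE E_eps.
have [Exi _] := finE E_xi; have [Eeta _] := finE E_eta.
elim: n a b => [|n IH] a b a0 b0.
  (* At generation 0 the main term is 0. One of the two initial terms has to exceed x / 2, and
     Markov's inequality of order r makes this o(g). *)
  have [C1 C10 hC1] := moment_tail mX0_rv r0 mom_X0 a0.
  have [C2 C20 hC2] := moment_tail mXm1_rv r0 mom_Xm1 b0.
  have nr := negl_scale g_rv (_ : 0 < 2^-1) (negl_powR g_gt0 g_noninc g_rv alpha0 alpha_r).
  apply: negl_near (neglZ (C1 + C2) (nr _)) => //.
  near=> x; have x0 : 0 < x by near: x; exact: nbhs_pinfty_gt.
  have x20 : 0 < 2^-1 * x by rewrite mulr_gt0.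
  rewrite subr0 ger0_norm ?pr_ge0 //; apply: le_trans (ler_norm _).
  rewrite mulrDl; apply: le_trans (lerD (hC1 _ x20) (hC2 _ x20)).
  apply: le_trans (prU_le P _ _).
  - apply: pr_le => [||w /= hw].
    + exact: (measurable_drv (fun q : nat * nat => x < a * q.2%:R + b * q.1%:R)
        (drv_pair mXm1_rv mX0_rv)).
    + apply: measurableU; [exact: (measurable_drv (fun k : nat => 2^-1 * x < a * k%:R))|
        exact: (measurable_drv (fun k : nat => 2^-1 * x < b * k%:R))].
    + by case: (ltrP (2^-1 * x) (a * (X0 w)%:R)) => h; [left|right; lra].
  - exact: (measurable_drv (fun k : nat => 2^-1 * x < a * k%:R)).
  - exact: (measurable_drv (fun k : nat => 2^-1 * x < b * k%:R)).
have mZ := drv_pair_n mY iY n.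
have [EU EV] := Ex_pair n.
have rv_tail a' b' : 0 <= a' -> 0 <= b' -> rvO g alpha (lin_tail n a' b').
  move=> a'0 b'0; apply: (rvO_negl g_rv) (IH a' b' a'0 b'0) => //; last exact: rvO_lin_main.
  by move=> x; exact: pr_ge0.
(* For a = 0 nothing happens in the last generation: b X_n is the combination (b, 0) one generation
   earlier, and 0^alpha = 0 removes the jump term. *)
have [a_eq0|a_neq0] := eqVneq a 0.
  have := IH b 0 b0 (lexx _); rewrite a_eq0 => hb.
  apply: negl_ext hb => x; rewrite /= powR0; last by rewrite gt_eqF //; lra.
  rewrite !mul0r !add0r /lin_tail; congr (pr _ - _); apply/funext => w /=.
  by rewrite !mul0r addr0 add0r.
have a_gt0 : 0 < a by rewrite lt_neqAle eq_sym a_neq0.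
have ai0 : 0 < a^-1 by rewrite invr_gt0.
have ba0 : 0 <= b / a by rewrite divr_ge0 // ltW.
have hmxi := ltW h1; have hmeta := ltW h2.
have p_small e : 0 < e -> \forall x \near +oo, p1 x + p2 x + g x <= e.
  move=> e0; have e3 : 0 < e / 3 by lra.
  near=> x.
  have t1 : p1 x <= e / 3 by near: x; apply: tailP_small Exi e3.
  have t2 : p2 x <= e / 3 by near: x; apply: tailP_small Eeta e3.
  have t3 : g x <= e / 3 by near: x; apply: tailP_small Eeps e3.
  lra.
(* Coefficients (1, 1) at x / 2: the extra summand for immigration is absorbed once x >= 2. *)
have tail_tot : asymO g (fun x => pr [set w | x < @ntot R (pair n w)]).
  have [_ [C hC] _] := rv_tail 1 1 ler01 ler01.
  have h20 : (0 : R) < 2^-1 by rewrite invr_gt0.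
  have [C' hC'] := asymO_scale g_gt0 g_rv h20 (ex_intro _ C hC).
  exists C'; near=> x; have x2 : 2 <= x by near: x; exact: near_pinfty_ge.
  have : `|lin_tail n 1 1 (2^-1 * x)| <= C' * g x by near: x; apply: hC'.
  apply: le_trans; rewrite !ger0_norm ?pr_ge0 //; apply: pr_le => [||w /=].
  - exact: (measurable_drv (fun q : nat * nat => x < @ntot R q)).
  - exact: (measurable_drv (fun q : nat * nat => 2^-1 * x < 1 * q.2%:R + 1 * q.1%:R)).
  - by rewrite /ntot -natr1 natrD; lra.
have tail_wt : rvO g alpha (fun x => pr [set w | x < drift mxi meta (b / a) (pair n w)]).
  exact: (rv_tail (mxi + b / a) meta (addr_ge0 hmxi ba0) hmeta).
have := step_asym mY mZ (@uniq_offspring n) (hE n) (size_offspring n) (@Em n) (@m_le n)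
  (sum_m n) (sum_tail n) (@unif n) h1 h2 (ltW h3) ba0 EU EV alpha0 g_gt0 g_noninc g_rv
  p1_rv p2_rv g_rvO _ _ g_noninc p_small tail_tot tail_wt.
move=> /(_ (fun x y => tailP_noninc P (mxi_rv 0 0)) (fun x y => tailP_noninc P (meta_rv 0 0))).
(* The one-generation estimate with b / a in place of b is read at x / a. Regular variation of the
   three tails then yields the factor (1 / a)^(-alpha) = a^alpha. *)
move=> /(negl_scale g_rv ai0) hs.
have [_ _ q1] := p1_rv; have [_ _ q2] := p2_rv.
have inv_pow : (a^-1) `^ (- alpha) = a `^ alpha.
  by rewrite -powR_inv1 ?ltW // -powRrM mulrNN mul1r.
have hw := IH (a * mxi + b) (a * meta) (addr_ge0 (mulr_ge0 a0 hmxi) b0) (mulr_ge0 a0 hmeta).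
apply: negl_ext (neglD (neglD hs hw) (neglD (neglD (neglZ (mean n).2 (q1 _ ai0))
  (neglZ (mean n).1 (q2 _ ai0))) (g_rv ai0))) => x.
have e1 : lin_tail n.+1 a b x = pr [set w | a^-1 * x <
    (\sum_(i <- offspring n (pair n w)) Y i w)%:R + b / a * (pair n w).2%:R].
  congr (pr _); apply/funext => w; rewrite /mkset gw_pairS /=.
  rewrite -(ltr_pM2l ai0 x); congr (is_true (_ < _)).
  by field; rewrite gt_eqF.
have e2 : pr [set w | a^-1 * x < drift mxi meta (b / a) (pair n w)] =
    lin_tail n (a * mxi + b) (a * meta) x.
  congr (pr _); apply/funext => w; rewrite /mkset /drift.
  rewrite -[in RHS](ltr_pM2l ai0 x); congr (is_true (_ < _)).
  by field; rewrite gt_eqF.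
rewrite e1 /step_main e2 inv_pow /=; ring.
Unshelve. all: by end_near. Qed.

(** Since g is at most the main term, and thus eventually at most twice the tail of X_n, errors of
    size o(g) are negligible against both; this turns differences back into quotients. *)
Lemma gw_asym n : (0 < n)%N -> asym_equiv (tailP P (gw_X Xm1 X0 xi eta eps n)) (main n 1 0)
  /\ reg_var P (gw_X Xm1 X0 xi eta eps n) alpha.
Proof.
move=> n0; have g_ge0 x : 0 <= g x := ltW (g_gt0 x).
pose f := tailP P (gw_X Xm1 X0 xi eta eps n).
have hf : negl g (fun x => f x - main n 1 0 x).
  apply: negl_ext (lin_asym n ler01 (lexx 0)) => x; congr (_ - _).
  by congr (pr _); apply/funext => w /=; rewrite mul1r mul0r addr0.
have rvF := rvO_lin_main n 1 0.
have rvf : rvO g alpha f by apply: (rvO_negl g_rv _ rvF hf) => x; exact: pr_ge0.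
(* The immigration of the last generation enters with coefficient 1^alpha = 1, and all other terms
   are nonnegative; at least one generation is needed. *)
have gF x : g x <= main n 1 0 x.
  case: n n0 {f hf rvF rvf} => // n _ /=; rewrite powR1 mul1r.
  have [t1 _ _] := p1_rv; have [t2 _ _] := p2_rv; have [t3 t4] := mean_ge0 n.
  have [t5 _ _] := rvO_lin_main n (1 * mxi + 0) (1 * meta).
  have := t5 x; have := mulr_ge0 (t1 x) t3; have := mulr_ge0 (t2 x) t4; lra.
have F0 x : 0 < main n 1 0 x by exact: lt_le_trans (g_gt0 x) (gF x).
split.
  apply/cvgrPdist_le => e e0; near=> x.
  have h : `|f x - main n 1 0 x| <= e * g x by near: x; exact: hf.
  rewrite -/(f x) distrC -(ler_pM2r (F0 x)) -[X in _ * X <= _](gtr0_norm (F0 x)) -normrM.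
  rewrite mulrBl mul1r divfK ?gt_eqF //; apply: le_trans h _.
  by rewrite ler_wpM2l // ltW.
have gf : \forall x \near +oo, g x <= 2 * f x.
  have h2 : (0 : R) < 1 / 2 by [].
  near=> x.
  have : `|f x - main n 1 0 x| <= 1 / 2 * g x by near: x; exact: hf.
  by rewrite ler_norml => /andP[+ _]; have := gF x; lra.
move=> q q0; apply/cvgrPdist_le => e e0.
have e20 : 0 < e / 2 by lra.
have [_ _ hrv] := rvf; near=> x.
have h1 : `|f (q * x) - q `^ (- alpha) * f x| <= e / 2 * g x by near: x; exact: hrv.
have h2 : g x <= 2 * f x by near: x.
have f0 : 0 < f x by have := g_gt0 x; lra.
rewrite -/(f x) -/(f (q * x)) distrC -(ler_pM2r f0) -[X in _ * X <= _](gtr0_norm f0) -normrM.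
rewrite mulrBl divfK ?gt_eqF //; apply: le_trans h1 _.
by have := ler_wpM2l (ltW e20) h2; lra.
Unshelve. all: by end_near. Qed.

End LinearCombinations.

Theorem theorem3p8 (d : measure_display) (T : measurableType d) (R : realType)
  (P : probability T R)
  (Xm1 X0 : T -> nat) (xi eta : nat -> nat -> T -> nat) (eps : nat -> T -> nat)
  (alpha r : R) :
  (* independence and measurability of all the variables *)
  (forall k : gw_idx, nat_rv (gw_family Xm1 X0 xi eta eps k)) ->
  mutually_indep P (gw_family Xm1 X0 xi eta eps) ->
  (* identically distributed; generic copies xi 0 0, eta 0 0, eps 0 *)
  (forall n i, same_law P (xi n i) (xi 0%N 0%N)) ->
  (forall n j, same_law P (eta n j) (eta 0%N 0%N)) ->
  (forall n, same_law P (eps n) (eps 0%N)) ->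
  1 <= alpha ->
  reg_var P (xi 0%N 0%N) alpha ->
  reg_var P (eta 0%N 0%N) alpha ->
  reg_var P (eps 0%N) alpha ->
  asymp (tailP P (xi 0%N 0%N)) (tailP P (eta 0%N 0%N)) ->
  bigO_inf (tailP P (xi 0%N 0%N)) (tailP P (eps 0%N)) ->
  bigO_inf (tailP P (eta 0%N 0%N)) (tailP P (eps 0%N)) ->
  (0 < meanE P (xi 0%N 0%N) < +oo)%E ->
  (0 < meanE P (eta 0%N 0%N) < +oo)%E ->
  (0 < meanE P (eps 0%N) < +oo)%E ->
  alpha < r ->
  (momentE P X0 r < +oo)%E ->
  (momentE P Xm1 r < +oo)%E ->
  let mxi := fine (meanE P (xi 0%N 0%N)) in
  let meta := fine (meanE P (eta 0%N 0%N)) in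
  let meps := fine (meanE P (eps 0%N)) in
  let M := Mmat mxi meta in
  let m := mk mxi meta in
  let u := fun x : R => col2 (tailP P (xi 0%N 0%N) x) (tailP P (eta 0%N 0%N) x) in
  forall n : nat, (0 < n)%N ->
    asym_equiv (tailP P (gw_X Xm1 X0 xi eta eps n))
      (fun x : R =>
         \sum_(0 <= k < n)
            (m k) `^ alpha *
            ((col2 (fine (meanE P X0)) (fine (meanE P Xm1)))^T
               *m (M ^+ (n - k - 1))^T *m u x) 0 0
       + \sum_(1 <= i < n) \sum_(0 <= j < n - i)
            (m j) `^ alpha *
            ((col2 meps 0)^T *m (M ^+ (n - i - j - 1))^T *m u x) 0 0
       + \sum_(1 <= i < n.+1) (m (n - i)%N) `^ alpha * tailP P (eps 0%N) x)
    /\ reg_var P (gw_X Xm1 X0 xi eta eps n) alpha.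
Proof.
move=> mY iY law_xi law_eta law_eps alpha1 rv_xi rv_eta rv_eps _ O_xi O_eta
  E_xi E_eta E_eps alpha_r mom_X0 mom_Xm1 mxi meta meps M m u n n0.
have [h1 h2] := gw_asym mY iY law_xi law_eta law_eps alpha1 rv_xi rv_eta rv_eps O_xi O_eta
  E_xi E_eta E_eps alpha_r mom_X0 mom_Xm1 n0.
split=> //.
have fine_gt0 (x : \bar R) : (0 < x < +oo)%E -> 0 < fine x.
  by case: x => [x||] //=; rewrite ?andbF // lte_fin => /andP[].
move: h1; congr asym_equiv; apply/funext => x.
by rewrite lin_main_closed //; exact: fine_gt0.
Qed.
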